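(* For $|q|<1$ (with $q^{1/2}$ a fixed square root of $q$, all fractional powers of $q$ being interpreted consistently via $q^{1/2}$), the following three identities hold: \begin{align*} \sum_{i,j,k\geq 0} \frac{q^{\frac{1}{2}i^2+j^2+k^2-ik-jk-\frac{1}{2}i-\frac{1}{2}j}}{(q;q)_i(q^2;q^2)_j(q^2;q^2)_k}&=4(1+q^{-1/2})\frac{(q^2;q^2)_\infty}{(q^{1/2};q^{1/2})_\infty},\\ \sum_{i,j,k\geq 0} \frac{q^{\frac{1}{2}i^2+j^2+k^2-ik-jk+\frac{1}{2}i+j-k}}{(q;q)_i(q^2;q^2)_j(q^2;q^2)_k}&=3\frac{(q^2;q^2)_\infty^3}{(q;q)_\infty^3},\\ \sum_{i,j,k\geq 0} \frac{q^{\frac{1}{2}i^2+j^2+k^2-ik-jk+\frac{1}{2}i+j}}{(q;q)_i(q^2;q^2)_j(q^2;q^2)_k}&=\frac{(q^2;q^2)_\infty^3}{(q;q)_\infty^3}. \end{align*}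
   Context: For a complex number $a$ and $|q|<1$, $(a;q)_n:=\prod_{k=0}^{n-1}(1-aq^k)$ for $n\in\mathbb{N}\cup\{\infty\}$. Sums run over nonnegative integers $i,j,k$. *)

(* Defs.v *)
From HB Require Import structures.
From mathcomp Require Import all_boot all_order all_algebra.
From mathcomp Require Import all_classical all_reals all_analysis.
From mathcomp Require Import complex.
Set Implicit Arguments. Unset Strict Implicit. Unset Printing Implicit Defensive.
Import Order.TTheory GRing.Theory Num.Theory.
Import numFieldNormedType.Exports.
(* Equip the complex numbers R[i] with their normed-module structure over
   themselves (the library only provides this for abstract numFieldTypes). *)
HB.instance Definition _ (R : realType) := GRing.ComAlgebra.copy R[i] R[i]^o.
HB.instance Definition _ (R : realType) := Vector.copy R[i] R[i]^o.
HB.instance Definition _ (R : realType) := NormedModule.copy R[i] R[i]^o.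

Local Open Scope ring_scope.
Local Open Scope complex_scope.
Local Open Scope classical_set_scope.
Local Open Scope ring_scope.

Definition qpoch (R : realType) (a q : R[i]) (n : nat) : R[i] :=
  \prod_(k < n) (1 - a * q ^+ k).

Definition qpoch_inf (R : realType) (a q : R[i]) : R[i] :=
  lim (qpoch a q @ \oo).

Definition cube_sum (R : realType) (F : nat -> nat -> nat -> R[i]) (N : nat)
  : R[i] := \sum_(i < N) \sum_(j < N) \sum_(k < N) F i j k.

(* Main.v *)
Require Import Defs.
From HB Require Import structures.
From mathcomp Require Import all_boot all_order all_algebra.
From mathcomp Require Import all_classical all_reals all_analysis.
From mathcomp Require Import complex ring lra zify.
Set Implicit Arguments. Unset Strict Implicit. Unset Printing Implicit Defensive.
Import Order.TTheory GRing.Theory Num.Theory.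
Import numFieldNormedType.Exports.
Local Open Scope ring_scope.
Local Open Scope complex_scope.
Local Open Scope classical_set_scope.
Local Open Scope ring_scope.

(** Write [P = (-q; q)_oo]. In each triple sum the sum over [i] is, by Euler's
    formula, [(-q^(d - k); q)_oo], a monomial times a finite [q]-shifted factorial
    times [P]. For the first sum, and for the sum of the last two, this factor
    cancels half of [(q^2; q^2)_k] and Euler's formula applies to [k] and then
    to [j]; the outcome is [4 P^2 (-q^(-1/2); q)_oo] and [4 P^3] respectively.
    For the third sum alone, one sums over [i] and [j] first and splits the sum
    over [k] by parity. The [q]-binomial theorem and a partial fraction expansion
    turn both halves into Lambert series, which add up to [1 / 2] because their
    double series expansions cancel; hence the third sum is [P^3] and the second
    one is [4 P^3 - P^3]. All rearrangements are justified by domination by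
    [K |q^(1/2)|^(i + j + k)]. *)

(** * Sequences converging at a geometric rate *)

(** With [c = K / (1 - r)], the sequence [u n - c r^n] is nondecreasing and [u n + c r^n]
    nonincreasing. The supremum of the former lies between the two, which gives the limit together
    with its rate. *)
Lemma real_geometric_cauchy (R : realType) (u : nat -> R) (K r : R) :
  0 <= r < 1 -> (forall n, `|u n.+1 - u n| <= K * r ^+ n) ->
  exists l, forall n, `|u n - l| <= K / (1 - r) * r ^+ n.
Proof.
move=> /andP[r0 r1] uK; pose c := K / (1 - r).
have cE n : K * r ^+ n = c * r ^+ n - c * r ^+ n.+1.
  by rewrite /c exprS; field; rewrite subr_eq0 gt_eqF.
have K0 : 0 <= K by have := le_trans (normr_ge0 _) (uK 0%N); rewrite expr0 mulr1.
have c0 n : 0 <= c * r ^+ n.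
  by rewrite mulr_ge0 ?exprn_ge0// divr_ge0// subr_ge0 ltW.
pose a n := u n - c * r ^+ n; pose b n := u n + c * r ^+ n.
have uK' n : - (c * r ^+ n - c * r ^+ n.+1) <= u n.+1 - u n <= c * r ^+ n - c * r ^+ n.+1.
  by rewrite -ler_norml -cE.
have aS : {homo a : m n / (m <= n)%N >-> m <= n}.
  apply: homo_leq => //; first exact: le_trans.
  by move=> n; rewrite /a; have /andP[] := uK' n; lra.
have bS : {homo b : m n / (m <= n)%N >-> n <= m}.
  apply: homo_leq => //; first by move=> x y z xy /le_trans; apply.
  by move=> n; rewrite /b; have /andP[] := uK' n; lra.
have ab m n : a m <= b n.
  apply: (@le_trans _ _ (a (maxn m n))); first by apply: aS; rewrite leq_maxl.
  apply: (@le_trans _ _ (b (maxn m n))); last by apply: bS; rewrite leq_maxr.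
  by rewrite /a /b; have := c0 (maxn m n); lra.
have sa : has_sup (range a).
  split; first by exists (a 0%N); exists 0%N.
  by exists (b 0%N) => _ [m _ <-].
exists (sup (range a)) => n; rewrite -/c ler_norml.
have : a n <= sup (range a) by apply: sup_upper_bound => //; exists n.
have : sup (range a) <= b n.
  by apply: ge_sup; [exists (a 0%N); exists 0%N | move=> _ [m _ <-]].
by rewrite /a /b => ? ?; apply/andP; split; lra.
Qed.

(** The real case is applied to real and imaginary parts, and the factor 2 adds the two errors. The
    complex [K] and [r] are real because they are comparable with 0. *)
Lemma geometric_cauchy (R : realType) (u : nat -> R[i]) (K r : R[i]) :
  0 <= r < 1 -> (forall n, `|u n.+1 - u n| <= K * r ^+ n) ->
  exists l, forall n, `|u n - l| <= 2 * (K / (1 - r)) * r ^+ n.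
Proof.
move=> /andP[r0 r1] uK.
have K0 : 0 <= K by have := le_trans (normr_ge0 _) (uK 0%N); rewrite expr0 mulr1.
have /complex_realP[k Kk] := ger0_real K0.
have /complex_realP[x rx] := ger0_real r0.
have x01 : 0 <= x < 1 by rewrite -ler0c -(ltcR x 1) -rx r0 r1.
have uKx n : `|u n.+1 - u n| <= (k * x ^+ n)%:C.
  by rewrite rmorphM rmorphXn /= -Kk -rx.
have [] := @real_geometric_cauchy R (fun n => complex.Re (u n)) k x x01.
  move=> n; rewrite -lecR; apply: le_trans (uKx n).
  by have := normc_ge_Re (u n.+1 - u n); rewrite raddfB.
move=> l1 ul1.
have [] := @real_geometric_cauchy R (fun n => complex.Im (u n)) k x x01.
  move=> n; rewrite -lecR; apply: le_trans (uKx n).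
  have := normc_ge_Re ((u n.+1 - u n) * - 'i).
  rewrite normrM normrN (_ : `|'i| = 1) ?mulr1; last by rewrite normCi.
  by rewrite mulrN raddfN /= ReiNIm opprK raddfB.
move=> l2 ul2.
exists (l1 +i* l2) => n.
set c := _ / _ in ul1 ul2.
have -> : 2 * (K / (1 - r)) * r ^+ n = (c * x ^+ n)%:C + (c * x ^+ n)%:C.
  rewrite Kk rx /c !(rmorphM, rmorphXn) fmorphV rmorphB rmorph1 /=; ring.
rewrite [u n - _]complexE.
apply: (le_trans (ler_normD _ _)); rewrite lerD// ?normrM ?normCi ?mul1r.
- by rewrite raddfB/= normc_def /= expr0n addr0 sqrtr_sqr lecR.
- by rewrite raddfB/= normc_def /= expr0n addr0 sqrtr_sqr lecR.
Qed.

Lemma geometric_cvg (R : realType) (u : nat -> R[i]) (l K r : R[i]) :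
  0 <= r < 1 -> (forall n, `|u n - l| <= K * r ^+ n) -> u @ \oo --> l.
Proof.
move=> /andP[r0 r1] uK.
have K0 : 0 <= K by have := le_trans (normr_ge0 _) (uK 0%N); rewrite expr0 mulr1.
have /complex_realP[k Kk] := ger0_real K0.
have /complex_realP[x rx] := ger0_real r0.
have /andP[x0 x1] : 0 <= x < 1 by rewrite -ler0c -(ltcR x 1) -rx r0 r1.
apply/cvgrPdist_le => e e0.
have /complex_realP[y ey] := ger0_real (ltW e0).
have y0 : 0 < y by rewrite -ltcR -ey.
have xlt : `|x| < 1 by rewrite ger0_norm.
have /cvgrPdist_le/(_ y y0) := @cvg_geometric R k x xlt.
apply: filterS => n; rewrite sub0r normrN => kx.
rewrite distrC; apply: (le_trans (uK n)); rewrite Kk rx ey -rmorphXn -rmorphM lecR.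
exact: le_trans (ler_norm _) kx.
Qed.

Lemma geometric_lim (R : realType) (u : nat -> R[i]) (l K r : R[i]) :
  0 <= r < 1 -> (forall n, `|u n - l| <= K * r ^+ n) -> lim (u @ \oo) = l.
Proof.
by move=> r01 uK; apply: (cvg_lim _ (geometric_cvg r01 uK)); exact: norm_hausdorff.
Qed.

(** The main tool for identities between limits: both sides are exhibited as limits of one sequence,
    with a geometric rate. *)
Lemma geometric_unique (R : realType) (u : nat -> R[i]) (l l' K K' r : R[i]) :
  0 <= r < 1 -> (forall n, `|u n - l| <= K * r ^+ n) ->
  (forall n, `|u n - l'| <= K' * r ^+ n) -> l = l'.
Proof.
move=> r01 uK uK'.
by rewrite -(geometric_lim r01 uK) (geometric_lim r01 uK').
Qed.

(** * Geometrically dominated series *)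

(* Only meaningful for convergent series: [lim] is a junk value otherwise. *)
Definition tsum (R : realType) (f : nat -> R[i]) : R[i] :=
  lim ((fun N => \sum_(n < N) f n) @ \oo).

Lemma eq_tsum (R : realType) (f g : nat -> R[i]) : f =1 g -> tsum f = tsum g.
Proof. by move=> /funext ->. Qed.

Lemma sum_geometric_le (F : numFieldType) (r : F) N :
  0 <= r < 1 -> \sum_(m < N) r ^+ m <= (1 - r)^-1.
Proof.
move=> /andP[r0 r1]; have d0 : 0 < 1 - r by rewrite subr_gt0.
rewrite -(ler_pM2l d0) mulfV ?gt_eqF//.
have -> : (1 - r) * \sum_(m < N) r ^+ m = 1 - r ^+ N.
  by rewrite -opprB mulNr -subrX1 opprB.
by rewrite gerBl exprn_ge0.
Qed.

Section GeometricSums.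
Variables (R : realType) (r : R[i]).
Hypothesis r01 : 0 <= r < 1.
Local Notation C := R[i].
Implicit Types (f g u v : nat -> C) (K : C).

Let r0 : 0 <= r. Proof. by case/andP: r01. Qed.
Let r1 : r <= 1. Proof. by case/andP: r01 => _ /ltW. Qed.
Let rn0 n : 0 <= r ^+ n. Proof. exact: exprn_ge0. Qed.
Let Dpos : 0 <= 2 / (1 - r).
Proof. by rewrite divr_ge0 ?subr_ge0. Qed.

Definition dom f := exists K, forall n, `|f n| <= K * r ^+ n.
Definition bnd u := exists K, forall n, `|u n| <= K.
Definition dom2 (f : nat -> nat -> C) :=
  exists K, forall m n, `|f m n| <= K * r ^+ (m + n).

Lemma tsum_unique f l K :
  (forall N, `|\sum_(n < N) f n - l| <= K * r ^+ N) -> tsum f = l.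
Proof. exact: geometric_lim. Qed.

(** The constant is explicit because double sums need tail bounds that are uniform in the other
    index. *)
Lemma tsum_tail f K : (forall n, `|f n| <= K * r ^+ n) ->
  forall N, `|\sum_(n < N) f n - tsum f| <= K * (2 / (1 - r)) * r ^+ N.
Proof.
move=> fK; have [] := @geometric_cauchy R (fun N => \sum_(n < N) f n) K r r01.
  by move=> n; rewrite big_ord_recr/= addrAC subrr add0r.
move=> l ul N; have -> : tsum f = l by exact: tsum_unique ul.
by apply: (le_trans (ul N)); rewrite mulrCA.
Qed.

Lemma tsum_norm f K : (forall n, `|f n| <= K * r ^+ n) ->
  `|tsum f| <= K * (2 / (1 - r)).
Proof.
by move=> /tsum_tail/(_ 0%N); rewrite big_ord0 sub0r normrN expr0 mulr1.
Qed.

Lemma tsum_geometric f : dom f ->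
  exists K, forall N, `|\sum_(n < N) f n - tsum f| <= K * r ^+ N.
Proof. by move=> [K /tsum_tail fK]; exists (K * (2 / (1 - r))). Qed.

Lemma tsumZ c f : dom f -> tsum (fun n => c * f n) = c * tsum f.
Proof.
move=> /tsum_geometric[K fK].
apply: (@tsum_unique _ _ (`|c| * K)) => N.
by rewrite -mulr_sumr -mulrBr normrM -mulrA ler_wpM2l.
Qed.

Lemma tsumD f g : dom f -> dom g ->
  tsum (fun n => f n + g n) = tsum f + tsum g.
Proof.
move=> /tsum_geometric[K fK] /tsum_geometric[K' gK].
apply: (@tsum_unique _ _ (K + K')) => N.
rewrite big_split/= opprD addrACA mulrDl.
apply: (le_trans (ler_normD _ _)); apply: lerD; [exact: fK | exact: gK].
Qed.

Lemma domZ c f : dom f -> dom (fun n => c * f n).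
Proof.
by move=> [K fK]; exists (`|c| * K) => n; rewrite normrM -mulrA ler_wpM2l.
Qed.

Lemma domD f g : dom f -> dom g -> dom (fun n => f n + g n).
Proof.
move=> [K fK] [K' gK]; exists (K + K') => n.
rewrite mulrDl; apply: (le_trans (ler_normD _ _)).
by apply: lerD; [exact: fK | exact: gK].
Qed.

Lemma domM u f : bnd u -> dom f -> dom (fun n => u n * f n).
Proof.
move=> [M uM] [K fK]; exists (M * K) => n.
by rewrite normrM -mulrA; apply: ler_pM.
Qed.

Lemma bndM u v : bnd u -> bnd v -> bnd (fun n => u n * v n).
Proof.
by move=> [M uM] [K fK]; exists (M * K) => n; rewrite normrM; apply: ler_pM.
Qed.

Lemma tsum_recl f : dom f -> tsum f = f 0%N + tsum (fun n => f n.+1).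
Proof.
move=> fd; have [K fK] := fd.
have /tsum_geometric[K' fK'] : dom (fun n => f n.+1).
  exists (K * r) => n; by apply: (le_trans (fK _)); rewrite exprS mulrA.
have [K2 fK2] := tsum_geometric fd.
apply: (@geometric_unique R (fun N => \sum_(n < N.+1) f n) _ _ (K2 * r) K' r r01) => N.
  by apply: (le_trans (fK2 _)); rewrite exprS mulrA.
have -> : \sum_(n < N.+1) f n = f 0%N + \sum_(n < N) f n.+1 by rewrite big_ord_recl.
by rewrite opprD addrACA subrr add0r; exact: fK'.
Qed.

Lemma tsum_parity f : dom f ->
  tsum f = tsum (fun n => f n.*2) + tsum (fun n => f n.*2.+1).
Proof.
move=> fd; have [K fK] := fd.
have K0 : 0 <= K by have := le_trans (normr_ge0 _) (fK 0%N); rewrite expr0 mulr1.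
have le2 n m : (n <= m)%N -> K * r ^+ m <= K * r ^+ n.
  by move=> nm; rewrite ler_wpM2l// ler_wiXn2l.
have d1 : dom (fun n => f n.*2).
  by exists K => n; apply: (le_trans (fK _)); apply: le2; lia.
have d2 : dom (fun n => f n.*2.+1).
  by exists K => n; apply: (le_trans (fK _)); apply: le2; lia.
have [K2 fK2] := tsum_geometric fd.
have K20 : 0 <= K2 by have := le_trans (normr_ge0 _) (fK2 0%N); rewrite expr0 mulr1.
rewrite -tsumD//; have [K3 fK3] := tsum_geometric (domD d1 d2).
(* Partial sums of [f] are compared only at even lengths, where they pair up exactly. *)
apply: (@geometric_unique R (fun N => \sum_(n < N.*2) f n) _ _ K2 K3 r r01) => N.
  apply: (le_trans (fK2 _)); rewrite ler_wpM2l// ler_wiXn2l//; lia.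
rewrite (_ : \sum_(n < N.*2) f n = \sum_(n < N) (f n.*2 + f n.*2.+1))//.
elim: N => [|N IH]; first by rewrite !big_ord0.
by rewrite doubleS !big_ord_recr/= IH addrA.
Qed.

Lemma dom2_row (f : nat -> nat -> C) : dom2 f -> forall m, dom (f m).
Proof.
by move=> [K fK] m; exists (K * r ^+ m) => n; rewrite -mulrA -exprD.
Qed.

Lemma dom2_tr (f : nat -> nat -> C) : dom2 f -> dom2 (fun m n => f n m).
Proof. by move=> [K fK]; exists K => m n; rewrite addnC. Qed.

Lemma dom2_tsum (f : nat -> nat -> C) K : (forall m n, `|f m n| <= K * r ^+ (m + n)) ->
  forall m, `|tsum (f m)| <= K * (2 / (1 - r)) * r ^+ m.
Proof.
move=> fK m; rewrite mulrAC; apply: tsum_norm => n.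
by rewrite -mulrA -exprD.
Qed.

(** With [D = 2 / (1 - r)], the tail of row [m] is at most [K D r^m r^N], and these bounds add up to
    a multiple of [r^N]. What remains is the tail of the series of row sums. *)
Lemma square_sum_geometric (f : nat -> nat -> C) : dom2 f ->
  exists K, forall N,
    `|\sum_(m < N) \sum_(n < N) f m n - tsum (fun m => tsum (f m))| <= K * r ^+ N.
Proof.
move=> [K fK].
have K0 : 0 <= K by have := le_trans (normr_ge0 _) (fK 0%N 0%N); rewrite expr0 mulr1.
pose D := 2 / (1 - r); have D0 : 0 <= D := Dpos.
exists (K * D * (1 - r)^-1 + K * D * D) => N.
rewrite -(subrKA (\sum_(m < N) tsum (f m))) mulrDl.
apply: (le_trans (ler_normD _ _)); apply: lerD; last first.
  exact: tsum_tail (dom2_tsum fK) N.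
rewrite -sumrB; apply: (le_trans (ler_norm_sum _ _ _)).
apply: (@le_trans _ _ (\sum_(m < N) K * D * r ^+ N * r ^+ m)).
  apply: ler_sum => m _.
  have := @tsum_tail (f m) (K * r ^+ m) _ N; rewrite -/D => H.
  rewrite mulrAC (mulrAC _ D); apply: H => n.
  by rewrite -mulrA -exprD.
rewrite -mulr_sumr [leRHS]mulrAC ler_wpM2l ?sum_geometric_le//.
by do 2?apply: mulr_ge0.
Qed.

(** Both iterated sums are limits of the same square partial sums. *)
Lemma tsum_exchange (f : nat -> nat -> C) : dom2 f ->
  tsum (fun m => tsum (f m)) = tsum (fun n => tsum (fun m => f m n)).
Proof.
move=> fd; have [K fK] := square_sum_geometric fd.
have [K' fK'] := square_sum_geometric (dom2_tr fd).
by apply: (geometric_unique r01 fK) => N; rewrite exchange_big.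
Qed.

(** The limit has [i] innermost because Euler's formula is applied to [i] first. The tails in [i]
    are summable over [j] and [k], so the cube is close to the square partial sum of the complete
    sums over [i]. *)
Lemma cube_sum_cvg (F : nat -> nat -> nat -> C) K :
  (forall i j k, `|F i j k| <= K * r ^+ (i + j + k)) ->
  cube_sum F @ \oo --> tsum (fun j => tsum (fun k => tsum (fun i => F i j k))).
Proof.
move=> FK; pose D := 2 / (1 - r); have D0 : 0 <= D := Dpos.
have K0 : 0 <= K by have := le_trans (normr_ge0 _) (FK 0%N 0%N 0%N); rewrite expr0 mulr1.
have gK j k : `|tsum (fun i => F i j k)| <= K * D * r ^+ (j + k).
  rewrite mulrAC; apply: tsum_norm => i.
  by rewrite -mulrA -exprD addnC addnA.
have [K' gK'] := @square_sum_geometric (fun j k => tsum (fun i => F i j k)) (ex_intro _ _ gK).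
apply: (geometric_cvg r01 (K := K * D * (1 - r)^-1 * (1 - r)^-1 + K')) => N.
have -> : cube_sum F N = \sum_(j < N) \sum_(k < N) \sum_(i < N) F i j k.
  rewrite /cube_sum exchange_big; apply: eq_bigr => j _; exact: exchange_big.
rewrite -(subrKA (\sum_(j < N) \sum_(k < N) tsum (fun i => F i j k))) mulrDl.
apply: (le_trans (ler_normD _ _)); apply: lerD => //.
rewrite -sumrB; apply: (le_trans (ler_norm_sum _ _ _)).
apply: (@le_trans _ _ (\sum_(j < N) K * D * (1 - r)^-1 * r ^+ N * r ^+ j)); last first.
  rewrite -mulr_sumr [leRHS]mulrAC ler_wpM2l ?sum_geometric_le//.
  by do 5?[apply: mulr_ge0 => //]; rewrite invr_ge0 subr_ge0.
apply: ler_sum => j _.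
rewrite -sumrB; apply: (le_trans (ler_norm_sum _ _ _)).
apply: (@le_trans _ _ (\sum_(k < N) K * D * r ^+ j * r ^+ N * r ^+ k)); last first.
  have -> : K * D * (1 - r)^-1 * r ^+ N * r ^+ j = K * D * r ^+ j * r ^+ N * (1 - r)^-1.
    by ring.
  rewrite -mulr_sumr ler_wpM2l ?sum_geometric_le//.
  by do 5?[apply: mulr_ge0 => //].
apply: ler_sum => k _.
have -> : K * D * r ^+ j * r ^+ N * r ^+ k = K * r ^+ (j + k) * D * r ^+ N.
  by rewrite exprD; ring.
apply: tsum_tail => i.
by rewrite -mulrA -exprD addnC addnA.
Qed.

(* A diagonal of length [n + 1] costs a factor [n + 1], which is why the
   domination is asked with ratio [r ^+ 2]. *)
Lemma tsum_diagonal (f : nat -> nat -> C) K :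
  (forall m n, `|f m n| <= K * (r ^+ 2) ^+ (m + n)) ->
  tsum (fun m => tsum (f m)) = tsum (fun n => \sum_(m < n.+1) f m (n - m)%N).
Proof.
move=> fK.
have K0 : 0 <= K by have := le_trans (normr_ge0 _) (fK 0%N 0%N); rewrite expr0 mulr1.
(* Column [n] of [g] is the [n]-th diagonal of [f], and row [m] of [g] is row [m] of [f] delayed by
   [m] zeros. On the support [m <= n], so [r^(2 n)] is at most [r^(m + n)]. *)
pose g m n := if (m <= n)%N then f m (n - m)%N else 0.
have gK m n : `|g m n| <= K * r ^+ (m + n).
  rewrite /g; case: leqP => mn; last by rewrite normr0 mulr_ge0.
  apply: (le_trans (fK _ _)); rewrite -exprM ler_wpM2l// ler_wiXn2l//; lia.
have dg : dom2 g by exists K.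
have df : dom2 f.
  exists K => m n; apply: (le_trans (fK _ _)).
  rewrite -exprM ler_wpM2l// ler_wiXn2l//; lia.
transitivity (tsum (fun m => tsum (g m))).
  apply: eq_tsum => m.
  have [K2 fK2] := tsum_geometric (dom2_row df m).
  have [K3 gK3] := tsum_geometric (dom2_row dg m).
  apply: (@geometric_unique R (fun N => \sum_(n < N) f m n) _ _ K2 (K3 * r ^+ m) r r01) => // N.
  rewrite -mulrA -exprD (_ : \sum_(n < N) f m n = \sum_(n < m + N) g m n)//.
  rewrite big_split_ord /= [X in _ = X + _]big1 ?add0r; last first.
    by move=> i _; rewrite /g leqNgt ltn_ord.
  by apply: eq_bigr => i _; rewrite /g leq_addr addKn.
rewrite tsum_exchange//; apply: eq_tsum => n.
have [K3 gK3] := tsum_geometric (dom2_row (dom2_tr dg) n).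
apply: (@geometric_unique R (fun N => \sum_(m < n.+1 + N) g m n) _ _ (K3 * r ^+ n.+1) 0 r r01) => N.
  by rewrite -mulrA -exprD.
rewrite big_split_ord /= [X in _ + X - _]big1 ?addr0; last first.
  by move=> i _; rewrite /g leqNgt addSn ltnS leq_addr.
rewrite mul0r (eq_bigr (fun m : 'I_n.+1 => f m (n - m)%N)) ?subrr ?normr0//.
by move=> i _; rewrite /g -ltnS ltn_ord.
Qed.

End GeometricSums.

(** * Shifted factorials and the q-binomial theorem *)

Lemma qpoch0 (R : realType) (a p : R[i]) : qpoch a p 0 = 1.
Proof. by rewrite /qpoch big_ord0. Qed.

Lemma qpochS (R : realType) (a p : R[i]) n :
  qpoch a p n.+1 = qpoch a p n * (1 - a * p ^+ n).
Proof. by rewrite /qpoch big_ord_recr. Qed.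

Lemma qpochD (R : realType) (a p : R[i]) m n :
  qpoch a p (m + n) = qpoch a p m * qpoch (a * p ^+ m) p n.
Proof.
elim: n => [|n IH]; first by rewrite addn0 qpoch0 mulr1.
by rewrite addnS !qpochS IH -!mulrA exprD.
Qed.

Lemma qpochSl (R : realType) (a p : R[i]) n :
  qpoch a p n.+1 = (1 - a) * qpoch (a * p) p n.
Proof. by rewrite -add1n qpochD qpochS qpoch0 mul1r expr0 mulr1 expr1. Qed.

Lemma qpoch_double (R : realType) (a p : R[i]) n :
  qpoch a p n.*2 = qpoch a (p ^+ 2) n * qpoch (a * p) (p ^+ 2) n.
Proof.
elim: n => [|n IH]; first by rewrite !qpoch0 mulr1.
rewrite doubleS !qpochS IH -exprM mul2n [p ^+ n.*2.+1]exprS; ring.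
Qed.

Lemma qpoch_doubleS (R : realType) (a p : R[i]) n :
  qpoch a p n.*2.+1 = qpoch a (p ^+ 2) n.+1 * qpoch (a * p) (p ^+ 2) n.
Proof. by rewrite !qpochS qpoch_double -exprM mul2n; ring. Qed.

Lemma qpochMN (R : realType) (a p : R[i]) n :
  qpoch a p n * qpoch (- a) p n = qpoch (a ^+ 2) (p ^+ 2) n.
Proof.
elim: n => [|n IH]; first by rewrite !qpoch0 mulr1.
rewrite !qpochS -IH -exprM mulnC exprM; ring.
Qed.

Lemma norm1B_ge (R : realType) (a p : R[i]) n :
  `|p| <= 1 -> 1 - `|a| <= `|1 - a * p ^+ n|.
Proof.
move=> p1; apply: (@le_trans _ _ (`|1 : R[i]| - `|a * p ^+ n|)).
  by rewrite normr1 lerD2l lerN2 normrM normrX ler_piMr ?exprn_ile1.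
exact: lerB_dist.
Qed.

Lemma sub1_neq0 (R : realType) (a p : R[i]) n :
  `|a| < 1 -> `|p| <= 1 -> 1 - a * p ^+ n != 0.
Proof.
move=> a1 p1; rewrite -normr_gt0; apply: lt_le_trans (norm1B_ge a n p1).
by rewrite subr_gt0.
Qed.

Lemma qpoch_neq0 (R : realType) (a p : R[i]) n :
  `|a| < 1 -> `|p| <= 1 -> qpoch a p n != 0.
Proof. by move=> a1 p1; apply/prodf_neq0 => k _; exact: sub1_neq0. Qed.

Section QPochhammer.
Variables (R : realType) (r : R[i]).
Hypothesis r01 : 0 <= r < 1.
Local Notation C := R[i].

Let r0 : 0 <= r. Proof. by case/andP: r01. Qed.
Let r1 : r < 1. Proof. by case/andP: r01. Qed.
Let rn0 n : 0 <= r ^+ n. Proof. exact: exprn_ge0. Qed.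

(** By [1 + x <= exp x] the product is at most the exponential of a geometric series. The estimate
    is carried out over the reals, where [expR] is defined. *)
Lemma bnd_prod (f : nat -> C) K : (forall k, `|f k| <= 1 + K * r ^+ k) -> 0 <= K ->
  bnd (fun n => \prod_(k < n) f k).
Proof.
move=> fK K0.
have /complex_realP[k Kk] := ger0_real K0.
have /complex_realP[x rx] := ger0_real r0.
have x01 : 0 <= x < 1 by rewrite -ler0c -(ltcR x 1) -rx r0 r1.
have k0 : 0 <= k by rewrite -ler0c -Kk.
have x0 : 0 <= x by case/andP: x01.
exists (expR (k / (1 - x)))%:C => n.
apply: (@le_trans _ _ (\prod_(i < n) (1 + k * x ^+ i))%:C).
  rewrite normr_prod rmorph_prod; apply: ler_prod => i _.
  by rewrite normr_ge0 /= rmorphD rmorph1 rmorphM rmorphXn /= -Kk -rx.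
rewrite lecR; apply: (@le_trans _ _ (\prod_(i < n) expR (k * x ^+ i))).
  apply: ler_prod => i _; rewrite expR_ge1Dx andbT.
  by rewrite addr_ge0 ?mulr_ge0 ?exprn_ge0.
rewrite -expR_sum ler_expR -mulr_sumr ler_wpM2l//.
exact: sum_geometric_le.
Qed.

Lemma qpoch_bnd (a p : C) : `|p| <= r -> bnd (qpoch a p).
Proof.
move=> pr; apply: (@bnd_prod (fun k => 1 - a * p ^+ k) `|a|) => // k.
apply: (le_trans (ler_normB _ _)); rewrite normr1 lerD2l normrM normrX.
by rewrite ler_wpM2l// lerXn2r ?nnegrE.
Qed.

(** Each inverse factor is [1 + y / (1 - y)] with [y = a p^k], and [|1 - y| >= 1 - |a|], so
    [bnd_prod] applies. *)
Lemma qpochV_bnd (a p : C) : `|p| <= r -> `|a| < 1 -> bnd (fun n => (qpoch a p n)^-1).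
Proof.
move=> pr a1.
have p1 : `|p| <= 1 by exact: le_trans pr (ltW r1).
have d0 : 0 < 1 - `|a| by rewrite subr_gt0.
have [] := @bnd_prod (fun k => (1 - a * p ^+ k)^-1) (`|a| / (1 - `|a|)).
- move=> k; have nz := sub1_neq0 k a1 p1.
  have -> : (1 - a * p ^+ k)^-1 = 1 + a * p ^+ k / (1 - a * p ^+ k) by field.
  apply: (le_trans (ler_normD _ _)); rewrite normr1 lerD2l normrM normfV mulrAC.
  apply: ler_pM => //.
    by rewrite normrM normrX ler_wpM2l// lerXn2r ?nnegrE.
  by rewrite lef_pV2 ?posrE ?normr_gt0// norm1B_ge.
- by rewrite divr_ge0// ltW.
by move=> M fM; exists M => n; rewrite /qpoch -prodfV.
Qed.

Lemma geometricM (u v : nat -> C) l l' :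
  (exists K, forall n, `|u n - l| <= K * r ^+ n) ->
  (exists K, forall n, `|v n - l'| <= K * r ^+ n) ->
  exists K, forall n, `|u n * v n - l * l'| <= K * r ^+ n.
Proof.
move=> [K uK] [L vL].
have K0 : 0 <= K by have := le_trans (normr_ge0 _) (uK 0%N); rewrite expr0 mulr1.
have L0 : 0 <= L by have := le_trans (normr_ge0 _) (vL 0%N); rewrite expr0 mulr1.
exists ((`|l| + K) * L + K * `|l'|) => n.
have -> : u n * v n - l * l' = u n * (v n - l') + (u n - l) * l' by ring.
rewrite [leRHS]mulrDl; apply: (le_trans (ler_normD _ _)); apply: lerD; rewrite normrM.
  rewrite -mulrA; apply: ler_pM => //.
  have -> : u n = l + (u n - l) by ring.
  apply: (le_trans (ler_normD _ _)); rewrite lerD2l.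
  by apply: (le_trans (uK _)); rewrite ler_piMr ?exprn_ile1// ltW.
by rewrite mulrAC ler_wpM2r.
Qed.

Lemma qpoch_rate (a p : C) : `|p| <= r ->
  exists K, forall n, `|qpoch a p n - qpoch_inf a p| <= K * r ^+ n.
Proof.
move=> pr; have [M uM] := qpoch_bnd a pr.
have [] := @geometric_cauchy R (qpoch a p) (M * `|a|) r r01.
  move=> n; rewrite qpochS mulrBr mulr1 addrAC subrr add0r normrN normrM normrM.
  rewrite -mulrA; apply: ler_pM => //.
  by rewrite normrX ler_wpM2l// lerXn2r ?nnegrE.
move=> l ul; have -> : qpoch_inf a p = l by exact: geometric_lim ul.
by eexists; exact: ul.
Qed.

Lemma qpoch_inf_unique (a p l K : C) :
  (forall n, `|qpoch a p n - l| <= K * r ^+ n) -> qpoch_inf a p = l.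
Proof. exact: geometric_lim. Qed.

Lemma qpoch_inf_split (a p : C) m : `|p| <= r ->
  qpoch_inf a p = qpoch a p m * qpoch_inf (a * p ^+ m) p.
Proof.
move=> pr; have [K uK] := qpoch_rate a pr; have [L vL] := qpoch_rate (a * p ^+ m) pr.
apply: (@geometric_unique R (fun n => qpoch a p (m + n)) _ _ (K * r ^+ m)
  (`|qpoch a p m| * L) r r01) => n.
  by apply: (le_trans (uK _)); rewrite exprD mulrA.
by rewrite qpochD -mulrBr normrM -mulrA ler_wpM2l.
Qed.

Lemma qpoch_inf_double (a p : C) : `|p| <= r ->
  qpoch_inf a p = qpoch_inf a (p ^+ 2) * qpoch_inf (a * p) (p ^+ 2).
Proof.
move=> pr.
have p2r : `|p ^+ 2| <= r.
  rewrite normrX expr2 -[leRHS]mulr1; apply: ler_pM => //.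
  exact: le_trans pr (ltW r1).
have [K uK] := qpoch_rate a pr.
have K0 : 0 <= K by have := le_trans (normr_ge0 _) (uK 0%N); rewrite expr0 mulr1.
have [L vL] := geometricM (qpoch_rate a p2r) (qpoch_rate (a * p) p2r).
apply: (@geometric_unique R (fun n => qpoch a p n.*2) _ _ K L r r01) => n.
  apply: (le_trans (uK _)); rewrite ler_wpM2l// ler_wiXn2l ?(ltW r1)//; lia.
by rewrite qpoch_double.
Qed.

Lemma qpoch_infMN (a p : C) : `|p| <= r ->
  qpoch_inf a p * qpoch_inf (- a) p = qpoch_inf (a ^+ 2) (p ^+ 2).
Proof.
move=> pr; have [K uK] := geometricM (qpoch_rate a pr) (qpoch_rate (- a) pr).
by apply/esym/(@qpoch_inf_unique _ _ _ K) => n; rewrite -qpochMN.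
Qed.

(** If the limit were 0, then 1, the product of [qpoch a p n] and its bounded inverse, would tend to
    0. *)
Lemma qpoch_inf_neq0 (a p : C) : `|p| <= r -> `|a| < 1 -> qpoch_inf a p != 0.
Proof.
move=> pr a1; apply/eqP => P0.
have [K uK] := qpoch_rate a pr; have [M vM] := qpochV_bnd pr a1.
have p1 : `|p| <= 1 by exact: le_trans pr (ltW r1).
suff : (1 : C) = 0 by apply/eqP; exact: oner_neq0.
apply: (@geometric_unique R (fun n => 1) _ _ 0 (M * K) r r01) => n.
  by rewrite subrr normr0 mul0r.
rewrite subr0 -(mulVf (qpoch_neq0 n a1 p1)) normrM -mulrA ler_pM//.
by have := uK n; rewrite P0 subr0.
Qed.

(** These are the coefficients of [(-v x; p)_oo / (u x; p)_oo]. Keeping both [u] and [v] makes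
    Euler's series ([u = 0]) and the series with [(a; p)_n / (p; p)_n] ([u = 1], [v = -a]) instances
    of one theorem. *)
Definition qcoef (u v p : C) n : C := \prod_(k < n) ((u + v * p ^+ k) / (1 - p ^+ k.+1)).

Lemma qcoefS u v p n :
  qcoef u v p n.+1 = qcoef u v p n * ((u + v * p ^+ n) / (1 - p ^+ n.+1)).
Proof. by rewrite /qcoef big_ord_recr. Qed.

(* The sum [F x] satisfies [(1 - u x) F x = (1 + v x) F (p x)], which is iterated
   down to [F 0 = 1]. *)
Lemma qbinomial (u v p x : C) : `|p| <= r -> dom r (fun n => qcoef u v p n * x ^+ n) ->
  qpoch_inf (u * x) p * tsum (fun n => qcoef u v p n * x ^+ n) =
  qpoch_inf (- (v * x)) p.
Proof.
move=> pr dx; pose F n := tsum (fun k => qcoef u v p k * (p ^+ n * x) ^+ k).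
have p1 : `|p| < 1 by exact: le_lt_trans pr r1.
have [K xK] := dx.
have K0 : 0 <= K by have := le_trans (normr_ge0 _) (xK 0%N); rewrite expr0 mulr1.
have FK n k : `|qcoef u v p k * (p ^+ n * x) ^+ k| <= K * r ^+ k * r ^+ (n * k).
  rewrite exprMn mulrCA normrM mulrC ler_pM// -exprM normrX.
  by rewrite lerXn2r ?nnegrE.
have Fd n : dom r (fun k => qcoef u v p k * (p ^+ n * x) ^+ k).
  by exists K => k; apply: (le_trans (FK _ _)); rewrite ler_piMr ?mulr_ge0// exprn_ile1// ltW.
(* Terms with [k >= 1] carry [r^(n k) <= r^n], so only the constant term survives in the limit. *)
have F1 : exists L, forall n, `|F n - 1| <= L * r ^+ n.
  exists (K * (2 / (1 - r))) => n.
  rewrite /F (tsum_recl r01)// /qcoef big_ord0 expr0 mulr1 addrAC subrr add0r mulrAC.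
  apply: (tsum_norm r01) => k; apply: (le_trans (FK _ _)).
  rewrite -!mulrA ler_wpM2l// -!exprD ler_wiXn2l ?(ltW r1)//; lia.
have Frec n : (1 - u * (p ^+ n * x)) * F n = (1 + v * (p ^+ n * x)) * F n.+1.
  set y := p ^+ n * x.
  have yE : p ^+ n.+1 * x = p * y by rewrite exprS mulrA.
  have dN : dom r (fun k => -1 * (qcoef u v p k * (p ^+ n.+1 * x) ^+ k)).
    exact: domZ.
  have e1 : F n - F n.+1 = tsum (fun k => (1 - p ^+ k) * (qcoef u v p k * y ^+ k)).
    rewrite -mulN1r -(tsumZ r01)// -(tsumD r01)//; apply: eq_tsum => k.
    rewrite yE -/y [(p * y) ^+ k]exprMn; ring.
  (* The constant terms cancel, and [(1 - p^(k + 1)) qcoef (k + 1) = (u + v p^k) qcoef k] lowers the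
     index of the others. *)
  have e2 : F n - F n.+1 = y * (u * F n + v * F n.+1).
    rewrite e1 (tsum_recl r01); last first.
      rewrite (_ : (fun k => _) = fun k => qcoef u v p k * y ^+ k + -1 * (qcoef u v p k * (p ^+ n.+1 * x) ^+ k)).
        exact: domD (Fd n) dN.
      apply/funext => k; rewrite yE -/y [(p * y) ^+ k]exprMn; ring.
    rewrite expr0 subrr mul0r add0r.
    rewrite -!(tsumZ r01)// -(tsumD r01); [|exact: domZ (Fd _)..].
    rewrite -(tsumZ r01); last exact: domD (domZ _ (Fd _)) (domZ _ (Fd _)).
    apply: eq_tsum => k; rewrite qcoefS yE -/y [(p * y) ^+ k]exprMn [y ^+ k.+1]exprS.
    have nz : 1 - p ^+ k.+1 != 0 by rewrite exprS sub1_neq0// ltW.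
    by field.
  clear e1 dN yE; move: (F n) (F n.+1) e2 => b c; clearbody y => e2.
  have -> : (1 - u * y) * b = (1 + v * y) * c + (b - c - y * (u * b + v * c)) by ring.
  by rewrite e2 subrr addr0.
have Fit n : qpoch (u * x) p n * F 0%N = qpoch (- (v * x)) p n * F n.
  elim: n => [|n IH]; first by rewrite !qpoch0.
  have e : 1 - u * x * p ^+ n = 1 - u * (p ^+ n * x) by ring.
  rewrite !qpochS mulrAC IH mulrAC -[LHS]mulrA e Frec; ring.
have F0 : exists L, forall n, `|F 0%N - F 0%N| <= L * r ^+ n.
  by exists 0 => n; rewrite subrr normr0 mul0r.
have [L uL] := geometricM (qpoch_rate (u * x) pr) F0.
have [L' vL] := geometricM (qpoch_rate (- (v * x)) pr) F1.
rewrite -[RHS]mulr1; transitivity (qpoch_inf (u * x) p * F 0%N).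
  by congr (_ * _); apply: eq_tsum => k; rewrite expr0 mul1r.
by apply: (geometric_unique r01 uL) => n; rewrite Fit.
Qed.

End QPochhammer.

(** * Reduction to Lambert series *)

Lemma qcoef0 (R : realType) (u v p : R[i]) : qcoef u v p 0 = 1.
Proof. by rewrite /qcoef big_ord0. Qed.

Lemma qcoef10 (R : realType) (a p : R[i]) n :
  qcoef 1 (- a) p n = qpoch a p n / qpoch p p n.
Proof.
elim: n => [|n IH]; first by rewrite qcoef0 !qpoch0 divr1.
by rewrite qcoefS IH !qpochS exprS mulNr mulf_div.
Qed.

(* With [e m = (-1)^m p^(m (m + 1) / 2) / (p; p)_m], the expansion of
   [1 / (a; p)_(n + 1)] into partial fractions in [a]. The recursion comes from
   [1 - p^n = (1 - p^(n - m)) + p^(n - m) (1 - p^m)]. *)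
Lemma partial_fractions (R : realType) (a p : R[i]) n :
  (forall k, 1 - a * p ^+ k != 0) -> (forall k, 1 - p ^+ k.+1 != 0) ->
  \sum_(m < n.+1) qcoef 0 (- p) p m / qpoch p p (n - m) / (1 - a * p ^+ m)
  = (qpoch a p n.+1)^-1.
Proof.
move=> a0 p0; elim: n a a0 => [|n IH] a a0.
  by rewrite big_ord1 qcoef0 subn0 qpochS !qpoch0 expr0 mulr1 invr1 !mul1r.
have hS k : (1 - p ^+ k.+1) / qpoch p p k.+1 = (qpoch p p k)^-1.
  rewrite qpochS -exprS invfM mulrCA mulfV ?mulr1//.
have eS k : (1 - p ^+ k.+1) * qcoef 0 (- p) p k.+1 = - p ^+ k.+1 * qcoef 0 (- p) p k.
  by rewrite qcoefS add0r [p ^+ k.+1]exprS; field; rewrite -exprS.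
have a0' k : 1 - a * p * p ^+ k != 0 by rewrite -mulrA -exprS.
apply: (mulfI (p0 n)).
(* Over the common denominator [(a; p)_(n + 2)] this is [1 - p^(n + 1) = (1 - a p^(n + 1)) - p^(n +
   1) (1 - a)]. *)
have -> : (1 - p ^+ n.+1) / qpoch a p n.+2 =
    (qpoch a p n.+1)^-1 - p ^+ n.+1 / qpoch (a * p) p n.+1.
  have P0 k : qpoch a p k != 0 by apply/prodf_neq0 => i _; exact: a0.
  have := P0 n.+2; rewrite qpochSl mulf_eq0 negb_or => /andP[a1 aP].
  have e1 : qpoch a p n.+1 * (1 - a * p ^+ n.+1) = (1 - a) * qpoch (a * p) p n.+1.
    by rewrite -qpochS -qpochSl.
  have e2 : (qpoch a p n.+1)^-1 = (1 - a * p ^+ n.+1) / ((1 - a) * qpoch (a * p) p n.+1).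
    by rewrite -e1 invfM mulrCA mulfV ?mulr1.
  by rewrite e2; field; rewrite a1 aP.
rewrite -(IH a a0) -(IH (a * p) a0') !mulr_sumr.
transitivity (\sum_(m < n.+2)
    ((1 - p ^+ (n.+1 - m)) * (qcoef 0 (- p) p m / qpoch p p (n.+1 - m) / (1 - a * p ^+ m))
   + p ^+ (n.+1 - m) * (1 - p ^+ m) * (qcoef 0 (- p) p m / qpoch p p (n.+1 - m) / (1 - a * p ^+ m)))).
  apply: eq_bigr => m _.
  have -> : p ^+ n.+1 = p ^+ (n.+1 - m) * p ^+ m by rewrite -exprD subnK// -ltnS.
  by ring.
(* The first half loses its term [m = n + 1] and is the case [a] of the induction hypothesis. The
   second loses its term [m = 0] and is [-p^(n + 1)] times the case [a p]. *)
rewrite big_split /=; congr (_ + _).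
  rewrite big_ord_recr /= subnn expr0 subrr mul0r addr0; apply: eq_bigr => m _.
  rewrite subSn ?leq_ord// -(hS (n - m)%N); ring.
rewrite big_ord_recl /= expr0 subrr mulr0 mul0r add0r -sumrN; apply: eq_bigr => m _.
rewrite /bump leq0n add1n subSS.
have -> : p ^+ n.+1 = p ^+ (n - m) * p ^+ m.+1.
  by rewrite -exprD addnS subnK// -ltnS.
transitivity (p ^+ (n - m) * ((1 - p ^+ m.+1) * qcoef 0 (- p) p m.+1)
   / qpoch p p (n - m) / (1 - a * p ^+ m.+1)); first by ring.
by rewrite eS -[a * p * _]mulrA -exprS; ring.
Qed.

Section LambertReduction.
Variables (R : realType) (r a p t : R[i]).
Hypothesis r01 : 0 <= r < 1.
Hypothesis pr : `|p| <= r.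
Hypothesis tr : `|t| <= r ^+ 2.
Hypothesis at1 : `|a * t| < 1.
Hypothesis a0 : forall k, 1 - a * p ^+ k != 0.
Hypothesis aB : bnd (fun k => (1 - a * p ^+ k)^-1).

Let r0 : 0 <= r. Proof. by case/andP: r01. Qed.
Let r1 : r < 1. Proof. by case/andP: r01. Qed.
Let p1 : `|p| < 1. Proof. exact: le_lt_trans pr r1. Qed.
Let tr1 : `|t| <= r.
Proof. by rewrite (le_trans tr)// expr2 ler_piMr// ltW. Qed.

Let hB : bnd (fun n => (qpoch p p n)^-1). Proof. exact: (qpochV_bnd r01). Qed.

Let eB : bnd (qcoef 0 (- p) p).
Proof.
have [M hM] := hB; exists M => n; apply: le_trans (hM n).
have -> : qcoef 0 (- p) p n = \prod_(k < n) (- p * p ^+ k) / qpoch p p n.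
  rewrite /qcoef /qpoch -prodf_div; apply: eq_bigr => k _.
  by rewrite add0r exprS.
rewrite normrM ler_piMl// normr_prod; apply: prodr_ile1 => k _.
by rewrite normr_ge0 /= mulNr normrN -exprS normrX exprn_ile1// ltW.
Qed.

Let tn (n : nat) : `|t ^+ n| <= r ^+ n.
Proof. by rewrite normrX lerXn2r ?nnegrE. Qed.

Let domt (u : nat -> R[i]) : bnd u -> dom r (fun n => u n * t ^+ n).
Proof. by move=> uB; apply: domM => //; exists 1 => n; rewrite mul1r. Qed.

Lemma lambert_dom :
  dom r (fun m => qcoef 0 (- p) p m * t ^+ m * qpoch a p m
                  / ((1 - a * p ^+ m) * qpoch (a * t) p m)).
Proof.
have -> : (fun m => qcoef 0 (- p) p m * t ^+ m * qpoch a p m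
                  / ((1 - a * p ^+ m) * qpoch (a * t) p m)) =
  fun m => (qcoef 0 (- p) p m * (qpoch a p m *
     ((1 - a * p ^+ m)^-1 * (qpoch (a * t) p m)^-1))) * t ^+ m.
  by apply/funext => m; rewrite invfM; ring.
apply: domt; apply: bndM eB _; apply: bndM (qpoch_bnd r01 _ pr) _.
exact: bndM aB (qpochV_bnd r01 pr at1).
Qed.

(** The double series [f] below is summed in two ways. Summing over [n] by the [q]-binomial theorem
    gives the left side times [(a t; p)_oo / (t; p)_oo]. On the diagonal [m + n = N], partial
    fractions give [t^N (a; p)_N / (a; p)_(N + 1) = t^N / (1 - a p^N)]. *)
Lemma lambert_reduction :
  tsum (fun m => qcoef 0 (- p) p m * t ^+ m * qpoch a p m
                  / ((1 - a * p ^+ m) * qpoch (a * t) p m))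
  = qpoch_inf t p / qpoch_inf (a * t) p * tsum (fun n => t ^+ n / (1 - a * p ^+ n)).
Proof.
have t1 : `|t| < 1 by exact: le_lt_trans tr1 r1.
have Pt0 : qpoch_inf t p != 0 by exact: (qpoch_inf_neq0 r01).
have Pat0 : qpoch_inf (a * t) p != 0 by exact: (qpoch_inf_neq0 r01).
have atn m : qpoch (a * t) p m != 0 by apply: qpoch_neq0 => //; exact: ltW.
pose f m n := qcoef 0 (- p) p m / (1 - a * p ^+ m) * qpoch a p (m + n)
              / qpoch p p n * t ^+ (m + n).
have diag : tsum (fun m => tsum (f m)) = tsum (fun n => t ^+ n / (1 - a * p ^+ n)).
  have [E eE] := eB; have [A aA] := aB; have [P aP] := qpoch_bnd r01 a pr.
  have [H hH] := hB.
  rewrite (tsum_diagonal r01 (K := E * A * P * H)); last first.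
    move=> m n; rewrite /f !normrM; do 4?[apply: ler_pM => //].
    by rewrite normrX lerXn2r ?nnegrE ?exprn_ge0.
  apply: eq_tsum => n.
  have Pn0 : qpoch a p n != 0 by apply/prodf_neq0 => k _; exact: a0.
  have p0 k : 1 - p ^+ k.+1 != 0.
    by rewrite exprS; apply: sub1_neq0 => //; exact: ltW.
  have pf := partial_fractions n a0 p0.
  transitivity (t ^+ n * qpoch a p n * (qpoch a p n.+1)^-1); last first.
    by rewrite qpochS; field; rewrite Pn0 a0.
  rewrite -pf mulr_sumr; apply: eq_bigr => m _.
  rewrite /f subnKC ?leq_ord//; ring.
have row m : tsum (f m) = qcoef 0 (- p) p m * t ^+ m * qpoch a p m
    / ((1 - a * p ^+ m) * qpoch (a * t) p m) * (qpoch_inf (a * t) p / qpoch_inf t p).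
  have dq : dom r (fun n => qcoef 1 (- (a * p ^+ m)) p n * t ^+ n).
    apply: domt; rewrite (_ : qcoef _ _ _ = fun n => qpoch (a * p ^+ m) p n * (qpoch p p n)^-1).
      exact: bndM (qpoch_bnd r01 _ pr) hB.
    by apply/funext => n; rewrite qcoef10.
  have qb := qbinomial r01 pr dq.
  rewrite mul1r mulNr opprK mulrAC in qb.
  have -> : tsum (f m) = qcoef 0 (- p) p m / (1 - a * p ^+ m) * qpoch a p m * t ^+ m
      * tsum (fun n => qcoef 1 (- (a * p ^+ m)) p n * t ^+ n).
    rewrite -(tsumZ r01)//; apply: eq_tsum => n.
    rewrite /f qpochD qcoef10 exprD; ring.
  apply: (mulfI Pt0); rewrite mulrCA qb.
  rewrite (qpoch_inf_split r01 (a * t) m pr).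
  by field; rewrite Pt0 atn a0.
rewrite -diag (eq_tsum row).
rewrite [in RHS](@eq_tsum _ _ (fun m => (qpoch_inf (a * t) p / qpoch_inf t p) *
  (qcoef 0 (- p) p m * t ^+ m * qpoch a p m / ((1 - a * p ^+ m) * qpoch (a * t) p m))));
  last by move=> m; exact: mulrC.
rewrite (tsumZ r01 _ lambert_dom); field; exact/andP.
Qed.

End LambertReduction.

(** * Bounds for integer powers and evaluation of the Lambert series *)

Lemma normr_expz (F : numFieldType) (x : F) (n : int) : `|x ^ n| = `|x| ^ n.
Proof. by case: n => n; rewrite ?NegzE -?exprnN -?exprnP ?normfV ?normrX. Qed.

(** Turns a linear lower bound on an integer exponent into geometric domination; the deficit [M]
    goes into the constant. *)
Lemma expz_bound (F : numFieldType) (s : F) (z M : int) (n : nat) :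
  s != 0 -> `|s| < 1 -> n%:Z - M <= z -> `|s ^ z| <= `|s| ^ (- M) * `|s| ^+ n.
Proof.
move=> s0 s1 nz; have s0' : `|s| != 0 by rewrite normr_eq0.
have -> : z = - M + n%:Z + (absz (z + M - n%:Z)%R)%:Z by lia.
rewrite normr_expz !expfzDr// -!exprnP ler_piMr ?exprn_ile1 ?(ltW s1)//.
by rewrite mulr_ge0 ?exprz_ge0.
Qed.

Lemma tsum_expr (R : realType) (r x : R[i]) : 0 <= r < 1 -> `|x| <= r ->
  tsum (fun n => x ^+ n) = (1 - x)^-1.
Proof.
move=> r01 xr; have /andP[r0 r1] := r01.
have x1 : 1 - x != 0.
  by rewrite subr_eq0; apply/eqP => x1; have := le_lt_trans xr r1; rewrite -x1 normr1 ltxx.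
apply: (tsum_unique r01 (K := `|(1 - x)^-1|)) => N.
have -> : \sum_(n < N) x ^+ n - (1 - x)^-1 = - ((1 - x)^-1 * x ^+ N).
  have -> : \sum_(n < N) x ^+ n = (1 - x ^+ N) / (1 - x).
    by apply: (mulIf x1); rewrite mulfVK// mulrC -opprB mulNr -subrX1 opprB.
  by field.
by rewrite normrN normrM ler_wpM2l// normrX lerXn2r ?nnegrE.
Qed.

(* Expanding both denominators turns the two sums into the two iterated sums of
   [(-1)^(r + n) q^(r (2 n + 1))] over [r >= 1], [n >= 0], with opposite signs. *)
Lemma lambert_half (R : realType) (q : R[i]) : `|q| < 1 ->
  tsum (fun n => (- q) ^+ n / (1 + (q ^+ 2) ^+ n))
  + q * tsum (fun n => (- q ^+ 2) ^+ n / (1 + q * (q ^+ 2) ^+ n)) = 2^-1.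
Proof.
move=> q1; have r01 : 0 <= `|q| < 1 by rewrite normr_ge0.
have qle m n : (n <= m)%N -> `|q| ^+ m <= `|q| ^+ n.
  by move=> nm; rewrite ler_wiXn2l// ltW.
have qn n : `|q ^+ n.+1| <= `|q| by rewrite normrX -[leRHS]expr1 qle.
have dn n : 1 + q ^+ n.+1 != 0.
  have /= := @sub1_neq0 R (- q) q n; rewrite mulNr opprK -exprS; apply.
    by rewrite normrN.
  exact: ltW.
have den m : `|1 + (q ^+ 2) ^+ m|^-1 <= (1 - `|q|)^-1.
  rewrite lef_pV2 ?posrE ?subr_gt0//; last first.
    rewrite normr_gt0 -exprM; case: m => [|m]; last by rewrite mulnS dn.
    by rewrite muln0 expr0 (_ : 1 + 1 = 2%:R)// pnatr_eq0.
  case: m => [|m].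
    rewrite expr0 (_ : 1 + 1 = 2%:R)// normr_nat lerBlDr.
    by rewrite (le_trans (ler1n _ 2))// lerDl.
  have /= := @norm1B_ge R (- q) q (2 * m).+1 (ltW q1).
  by rewrite mulNr opprK normrN -exprS -exprM mulnS.
pose f m n : R[i] := (-1) ^+ (m + n) * q ^+ (m.+1 * n.*2.+1).
have fd : dom2 `|q| f.
  exists 1 => m n; rewrite mul1r normrM normrX normrN normr1 expr1n mul1r normrX.
  by apply: qle; nia.
have dE : dom `|q| (fun n => (- q) ^+ n / (1 + (q ^+ 2) ^+ n)).
  exists (1 - `|q|)^-1 => n; rewrite normrM normfV normrX normrN mulrC.
  by rewrite ler_wpM2r.
have e1 : q * tsum (fun n => (- q ^+ 2) ^+ n / (1 + q * (q ^+ 2) ^+ n))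
        = tsum (fun m => tsum (f m)).
  rewrite (tsum_exchange r01 fd) -(tsumZ r01); last first.
    exists (1 - `|q|)^-1 => n; rewrite normrM normfV normrX normrN mulrC.
    apply: ler_pM => //.
      rewrite lef_pV2 ?posrE ?subr_gt0//.
        have /= := @norm1B_ge R (- q) q (2 * n) (ltW q1).
        by rewrite mulNr opprK normrN -exprM.
      by rewrite normr_gt0 -exprM -exprS dn.
    by rewrite normrX -exprM; apply: qle; lia.
  apply: eq_tsum => n.
  transitivity (tsum (fun m => ((-1) ^+ n * q ^+ n.*2.+1) * (- q ^+ n.*2.+1) ^+ m)).
    rewrite (tsumZ r01); last first.
      by exists 1 => m; rewrite mul1r normrX normrN lerXn2r ?nnegrE.
    rewrite (tsum_expr r01) ?normrN// opprK [(- q ^+ 2) ^+ n]exprNn -!exprM -exprS mul2n.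
    by rewrite [q ^+ n.*2.+1]exprS; field; rewrite -exprS dn.
  apply: eq_tsum => m; rewrite /f exprD [(- q ^+ n.*2.+1) ^+ m]exprNn -exprM.
  have -> : (m.+1 * n.*2.+1 = n.*2.+1 + n.*2.+1 * m)%N by lia.
  by rewrite exprD; ring.
have e2 m : tsum (f m) = - ((- q) ^+ m.+1 / (1 + (q ^+ 2) ^+ m.+1)).
  transitivity (tsum (fun n => ((-1) ^+ m * q ^+ m.+1) * (- q ^+ (2 * m.+1)) ^+ n)).
    apply: eq_tsum => n; rewrite /f exprD [(- q ^+ (2 * m.+1)) ^+ n]exprNn -exprM.
    have -> : (m.+1 * n.*2.+1 = m.+1 + 2 * m.+1 * n)%N by lia.
    by rewrite exprD; ring.
  rewrite (tsumZ r01); last first.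
    by exists 1 => n; rewrite mul1r normrX normrN lerXn2r ?nnegrE// mulnS; exact: qn.
  rewrite (tsum_expr r01) ?opprK -?exprM; last by rewrite normrN mulnS; exact: qn.
  by rewrite [(- q) ^+ m.+1]exprNn [(-1) ^+ m.+1]exprS; ring.
(* The term [n = 0] of the first series is [1 / (1 + 1)]; everything else cancels. *)
rewrite e1 (eq_tsum e2) (tsum_recl r01 dE).
rewrite (@eq_tsum _ (fun n => - ((- q) ^+ n.+1 / (1 + (q ^+ 2) ^+ n.+1)))
  (fun n => -1 * ((- q) ^+ n.+1 / (1 + (q ^+ 2) ^+ n.+1)))); last first.
  by move=> n; rewrite mulN1r.
rewrite (tsumZ r01); last first.
  have [K dK] := dE; exists (K * `|q|) => n.
  by apply: (le_trans (dK _)); rewrite exprS mulrA.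
by rewrite !expr0 mulN1r addrK mul1r.
Qed.

(** * Euler sums with integer exponents *)

Section IntegerPowers.
Variables (R : realType) (s : R[i]).
Hypothesis s0 : s != 0.
Hypothesis s1 : `|s| < 1.
Let r01 : 0 <= `|s| < 1. Proof. by rewrite normr_ge0. Qed.
Let s2r : `|s ^+ 2| <= `|s|.
Proof. by rewrite normrX expr2 ler_piMl// ltW. Qed.
Let sD a b : s ^ (a + b) = s ^ a * s ^ b. Proof. exact: expfzDr. Qed.

(** With base [p = s^2], the Euler factor [p^(n (n - 1) / 2)] becomes [s^(n^2 - n)]. *)
Lemma qcoef01 (e : int) (n : nat) : qcoef 0 1 (s ^+ 2) n * (s ^ e) ^+ n =
  s ^ (n%:Z ^+ 2 - n%:Z + e * n%:Z) / qpoch (s ^+ 2) (s ^+ 2) n.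
Proof.
elim: n => [|n IH]; first by rewrite qcoef0 qpoch0 mulr0 !expr0 divr1 mulr1.
rewrite qcoefS [(s ^ e) ^+ n.+1]exprSr mulrACA IH qpochS add0r mul1r -exprS.
have -> : n.+1%:Z ^+ 2 - n.+1%:Z + e * n.+1%:Z
   = (n%:Z ^+ 2 - n%:Z + e * n%:Z) + (2 * n)%N%:Z + e.
  by rewrite PoszM -addn1 PoszD; ring.
by rewrite !sD -exprnP exprM invfM; ring.
Qed.

Lemma euler_dom (e : int) : dom `|s|
  (fun n : nat => s ^ (n%:Z ^+ 2 - n%:Z + e * n%:Z) / qpoch (s ^+ 2) (s ^+ 2) n).
Proof.
have [M hM] := @qpochV_bnd R `|s| r01 (s ^+ 2) (s ^+ 2) s2r (le_lt_trans s2r s1).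
(* Completing the square gives [n^2 - n + e n >= n - (e - 2)^2]. *)
exists (`|s| ^ (- (e - 2) ^+ 2) * M) => n; rewrite normrM [leRHS]mulrAC.
apply: ler_pM => //; apply: expz_bound => //.
have := sqr_ge0 (2 * n%:Z + e - 2); have := sqr_ge0 (e - 2); rewrite !expr2; lia.
Qed.

Lemma euler_sum (e : int) :
  tsum (fun n : nat => s ^ (n%:Z ^+ 2 - n%:Z + e * n%:Z) / qpoch (s ^+ 2) (s ^+ 2) n)
  = qpoch_inf (- s ^ e) (s ^+ 2).
Proof.
have dF : dom `|s| (fun n => qcoef 0 1 (s ^+ 2) n * (s ^ e) ^+ n).
  by under eq_fun => n do rewrite qcoef01; exact: euler_dom.
have := qbinomial r01 s2r dF; rewrite mul0r mul1r => <-.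
have -> : qpoch_inf 0 (s ^+ 2) = 1.
  apply: (@geometric_lim R (qpoch 0 (s ^+ 2)) 1 0 `|s| r01) => n.
  by rewrite /qpoch big1 ?subrr ?normr0 ?mul0r// => i _; rewrite mul0r subr0.
by rewrite mul1r; apply: eq_tsum => n; rewrite qcoef01.
Qed.

(** Raising [k] adds the leading factor [1 + s^(e - 2 (k + 1)) = s^(e - 2 (k + 1)) (1 + s^(2 - e)
    s^(2 k))]. The powers of [s] collect into the monomial, the brackets into the finite product. *)
Lemma qpoch_inf_shift (e : int) (k : nat) :
  qpoch_inf (- s ^ (e - 2 * k%:Z)) (s ^+ 2) =
  s ^ (e * k%:Z - k%:Z ^+ 2 - k%:Z) * qpoch (- s ^ (2 - e)) (s ^+ 2) k
  * qpoch_inf (- s ^ e) (s ^+ 2).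
Proof.
elim: k => [|k IH]; first by rewrite qpoch0 !mulr0 !subr0 expr0z !mul1r.
rewrite (@qpoch_inf_split R `|s| r01 _ _ 1%N)// expr1 qpochS qpoch0 expr0 mulr1 mul1r.
have -> : - s ^ (e - 2 * k.+1%:Z) * s ^+ 2 = - s ^ (e - 2 * k%:Z).
  rewrite exprnP mulNr -sD; congr (- (s ^ _)); lia.
rewrite IH qpochS opprK mulNr opprK.
have -> : s ^ (e * k.+1%:Z - k.+1%:Z ^+ 2 - k.+1%:Z) =
   s ^ (e * k%:Z - k%:Z ^+ 2 - k%:Z) * s ^ (e - 2 * k.+1%:Z).
  rewrite -sD; congr (s ^ _); rewrite -addn1 PoszD; ring.
have -> : 1 + s ^ (e - 2 * k.+1%:Z) = s ^ (e - 2 * k.+1%:Z) * (1 + s ^ (2 - e) * (s ^+ 2) ^+ k).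
  rewrite mulrDr mulr1 addrC -exprM exprnP -!sD; congr (_ + _).
  rewrite -[LHS](expr0z s); congr (s ^ _); rewrite PoszM; lia.
by ring.
Qed.

End IntegerPowers.

Lemma doubleS_intr (m : nat) : m.*2.+1%:Z = 2 * m%:Z + 1.
Proof. lia. Qed.

(** Both sides are [(-1; p)_(n + 1)], split at its last and at its first factor. *)
Lemma qpochN1 (R : realType) (p : R[i]) n :
  qpoch (- 1) p n * (1 + p ^+ n) = 2 * qpoch (- p) p n.
Proof.
have -> : 1 + p ^+ n = 1 - (- 1) * p ^+ n by ring.
by rewrite -qpochS qpochSl opprK mulN1r.
Qed.

(** The sign of [-x] cancels the alternating sign of the coefficient, which brings the terms of
    [lambert_reduction] to the sign-free form met in the triple sum. *)
Lemma qcoef0N (R : realType) (p x : R[i]) n :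
  qcoef 0 (- p ^+ 2) (p ^+ 2) n * (- x) ^+ n =
  p ^+ (n * n + n) * x ^+ n / qpoch (p ^+ 2) (p ^+ 2) n.
Proof.
elim: n => [|n IH]; first by rewrite qcoef0 qpoch0 !expr0 divr1 !mulr1.
rewrite qcoefS qpochS [(- x) ^+ n.+1]exprSr mulrACA IH.
have -> : (n.+1 * n.+1 + n.+1 = (n * n + n) + (2 * n + 2))%N by lia.
rewrite [p ^+ (_ + (_ + _))]exprD [p ^+ (2 * n + 2)]exprD exprM [x ^+ n.+1]exprS.
rewrite [(p ^+ 2) ^+ n.+1]exprS invfM; ring.
Qed.

(** * The triple sums *)

Section DoubleSums.
Variables (R : realType) (r : R[i]).
Hypothesis r01 : 0 <= r < 1.
Implicit Types f g : nat -> nat -> R[i].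

Lemma dom2_dom_tsum f : dom2 r f -> dom r (fun m => tsum (f m)).
Proof. by move=> [K fK]; exists (K * (2 / (1 - r))); exact: dom2_tsum. Qed.

Lemma tsumZ2 c f : dom2 r f ->
  tsum (fun m => tsum (fun n => c * f m n)) = c * tsum (fun m => tsum (f m)).
Proof.
move=> fd; rewrite -(tsumZ r01); last exact: dom2_dom_tsum.
by apply: eq_tsum => m; rewrite (tsumZ r01)//; exact: dom2_row.
Qed.

Lemma tsumD2 f g : dom2 r f -> dom2 r g ->
  tsum (fun m => tsum (fun n => f m n + g m n)) =
  tsum (fun m => tsum (f m)) + tsum (fun m => tsum (g m)).
Proof.
move=> fd gd; rewrite -(tsumD r01); [|exact: dom2_dom_tsum..].
by apply: eq_tsum => m; rewrite (tsumD r01)//; exact: dom2_row.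
Qed.

End DoubleSums.

Section TripleSums.
Variables (R : realType) (s : R[i]).
Hypothesis s0 : s != 0.
Hypothesis s1 : `|s| < 1.
Local Notation q := (s ^+ 2).
Local Notation q2 := (s ^+ 2 ^+ 2).
Local Notation P := (qpoch_inf (- q) q).

Let r01 : 0 <= `|s| < 1. Proof. by rewrite normr_ge0. Qed.
Let q_neq0 : q != 0. Proof. by rewrite expf_neq0. Qed.
Let qr : `|q| <= `|s|.
Proof. by rewrite normrX expr2 ler_piMl// ltW. Qed.
Let q1 : `|q| < 1. Proof. exact: le_lt_trans qr s1. Qed.
Let q2r : `|q2| <= `|s|.
Proof. by rewrite normrX expr2 (le_trans _ qr)// ler_piMl// ltW. Qed.
Let q21 : `|q2| < 1. Proof. exact: le_lt_trans q2r s1. Qed.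
Let sD a b : s ^ (a + b) = s ^ a * s ^ b. Proof. exact: expfzDr. Qed.
Let sQ z : q ^ z = s ^ (2 * z). Proof. by rewrite exprnP exprz_exp. Qed.
Let sz2 : s ^ 2 = q. Proof. by []. Qed.
Let qq0 n : qpoch q q n != 0. Proof. exact: qpoch_neq0 (ltW _). Qed.
Let qq20 n : qpoch q2 q2 n != 0. Proof. exact: qpoch_neq0 (ltW _). Qed.
Let qqN0 n : qpoch (- q) q n != 0.
Proof. by apply: qpoch_neq0 (ltW _) => //; rewrite normrN. Qed.

Lemma qpoch_inf_N1 : qpoch_inf (- 1) q = 2 * P.
Proof.
rewrite (qpoch_inf_split r01 _ 1 qr) qpochS qpoch0 expr0 expr1 !mul1r mulr1.
by rewrite opprK mulN1r.
Qed.

(** The double series common to the first sum ([c = -1]) and to the sum of the other two ([c = 2]),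
    once [(-q; q)_k] is cancelled from [(q^2; q^2)_k]. *)
Definition bterm (c : int) (j k : nat) : R[i] :=
  s ^ (k%:Z ^+ 2 - k%:Z - 2 * j%:Z * k%:Z + 2 * j%:Z ^+ 2 + c * j%:Z)
  / (qpoch q2 q2 j * qpoch q q k).

Lemma bterm_dom c : dom2 `|s| (bterm c).
Proof.
have [M hM] := qpochV_bnd r01 q2r q21; have [L hL] := qpochV_bnd r01 qr q1.
exists (`|s| ^ (- ((c - 3) ^+ 2 + 1)) * (M * L)) => j k.
rewrite /bterm normrM [leRHS]mulrAC invfM normrM; do 2?[apply: ler_pM => //].
(* The exponent minus [j + k] is [(k - j - 1)^2 - 1 + j^2 + (c - 3) j]. *)
apply: expz_bound => //; rewrite PoszD.
have := sqr_ge0 (k%:Z - j%:Z - 1); have := sqr_ge0 (2 * j%:Z + c - 3).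
have := sqr_ge0 (c - 3); rewrite !expr2; lia.
Qed.

(** Euler's formula in [k] and the shift from [(-1; q)_oo = 2 P] produce [(-q; q)_j]. It cancels
    half of [(q^2; q^2)_j] and leaves an Euler series in [j]. *)
Lemma bterm_sum c : tsum (fun j => tsum (bterm c j)) = 2 * P * qpoch_inf (- s ^ c) q.
Proof.
rewrite -(euler_sum s0 s1) -(tsumZ r01 _ (euler_dom s0 s1 c)); apply: eq_tsum => j.
transitivity (s ^ (2 * j%:Z ^+ 2 + c * j%:Z) / qpoch q2 q2 j *
    tsum (fun k : nat => s ^ (k%:Z ^+ 2 - k%:Z + (0 - 2 * j%:Z) * k%:Z) / qpoch q q k)).
  rewrite -(tsumZ r01 _ (euler_dom s0 s1 _)); apply: eq_tsum => k.
  rewrite /bterm invfM mulrACA -sD; congr (s ^ _ * _); ring.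
rewrite (euler_sum s0 s1) (qpoch_inf_shift s0 s1) expr0z qpoch_inf_N1 subr0.
rewrite -(qpochMN q q j) sz2.
have -> : s ^ (j%:Z ^+ 2 - j%:Z + c * j%:Z) =
  s ^ (2 * j%:Z ^+ 2 + c * j%:Z) * s ^ (0 * j%:Z - j%:Z ^+ 2 - j%:Z).
  by rewrite -sD; congr (s ^ _); ring.
by field; rewrite qq0 qqN0.
Qed.

(** Exponents are doubled since [s] is the square root of [q]. The three sums are the cases
    [(-1, -1, 0)], [(1, 2, -2)] and [(1, 2, 0)] of [(a, b, c)]. *)
Definition tterm (a b c : int) (i j k : nat) : R[i] :=
  s ^ (i%:Z ^+ 2 + 2 * j%:Z ^+ 2 + 2 * k%:Z ^+ 2 - 2 * i%:Z * k%:Z - 2 * j%:Z * k%:Z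
       + a * i%:Z + b * j%:Z + c * k%:Z)
  / (qpoch q q i * qpoch q2 q2 j * qpoch q2 q2 k).

Definition dterm (a b c : int) (j k : nat) : R[i] :=
  s ^ (2 * j%:Z ^+ 2 + k%:Z ^+ 2 - 2 * j%:Z * k%:Z + b * j%:Z + (a + c) * k%:Z)
  * qpoch (- s ^ (1 - a)) q k / (qpoch q2 q2 j * qpoch q2 q2 k)
  * qpoch_inf (- s ^ (a + 1)) q.

(* The quadratic form is [(i - k)^2 + (k - j)^2 + j^2]. *)
Lemma tterm_bound a b c :
  exists K, forall i j k, `|tterm a b c i j k| <= K * `|s| ^+ (i + j + k).
Proof.
have [M hM] := qpochV_bnd r01 q2r q21; have [L hL] := qpochV_bnd r01 qr q1.
(* After subtracting [i + j + k], the linear part has coefficients [a - 1], [a + c - 2] and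
   [a + b + c - 3] in [i - k], [k - j] and [j]; each square is completed separately. *)
exists (`|s| ^ (- ((a - 1) ^+ 2 + (a + c - 2) ^+ 2 + (a + b + c - 3) ^+ 2)) * (L * M * M)).
move=> i j k; rewrite /tterm normrM [leRHS]mulrAC !invfM !normrM; do 3?[apply: ler_pM => //].
apply: expz_bound => //; rewrite !PoszD.
have := sqr_ge0 (2 * (i%:Z - k%:Z) + (a - 1)).
have := sqr_ge0 (2 * (k%:Z - j%:Z) + (a + c - 2)).
have := sqr_ge0 (2 * j%:Z + (a + b + c - 3)).
have := sqr_ge0 (a - 1); have := sqr_ge0 (a + c - 2); have := sqr_ge0 (a + b + c - 3).
rewrite !expr2; lia.
Qed.

Lemma tterm_sum a b c j k : tsum (fun i => tterm a b c i j k) = dterm a b c j k.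
Proof.
transitivity (s ^ (2 * j%:Z ^+ 2 + 2 * k%:Z ^+ 2 - 2 * j%:Z * k%:Z + b * j%:Z + c * k%:Z)
    / (qpoch q2 q2 j * qpoch q2 q2 k) *
    tsum (fun i : nat => s ^ (i%:Z ^+ 2 - i%:Z + (a + 1 - 2 * k%:Z) * i%:Z) / qpoch q q i)).
  rewrite -(tsumZ r01 _ (euler_dom s0 s1 _)); apply: eq_tsum => i.
  rewrite /tterm; set A := s ^ _; set B := s ^ _; set D := s ^ _.
  have -> : A = B * D by rewrite /A /B /D -sD; congr (s ^ _); ring.
  by rewrite !invfM; ring.
rewrite (euler_sum s0 s1) (qpoch_inf_shift s0 s1) /dterm.
have -> : 2 - (a + 1) = 1 - a by ring.
have -> : s ^ (2 * j%:Z ^+ 2 + k%:Z ^+ 2 - 2 * j%:Z * k%:Z + b * j%:Z + (a + c) * k%:Z)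
  = s ^ (2 * j%:Z ^+ 2 + 2 * k%:Z ^+ 2 - 2 * j%:Z * k%:Z + b * j%:Z + c * k%:Z)
    * s ^ ((a + 1) * k%:Z - k%:Z ^+ 2 - k%:Z).
  by rewrite -sD; congr (s ^ _); ring.
by ring.
Qed.

Lemma dterm_dom a b c : dom2 `|s| (dterm a b c).
Proof.
have [K tK] := tterm_bound a b c; exists (K * (2 / (1 - `|s|))) => j k.
rewrite -tterm_sum mulrAC; apply: (tsum_norm r01) => i.
by rewrite -mulrA -exprD addnC addnA.
Qed.

Lemma tterm_cvg a b c :
  cube_sum (tterm a b c) @ \oo --> tsum (fun j => tsum (dterm a b c j)).
Proof.
have [K /(cube_sum_cvg r01)] := tterm_bound a b c.
congr (_ --> nbhs _); apply: eq_tsum => j; apply: eq_tsum => k; exact: tterm_sum.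
Qed.

(** For [a = -1] the infinite factor is [(-1; q)_oo = 2 P] and the finite one is [(-q; q)_k], which
    cancels half of [(q^2; q^2)_k]. *)
Lemma first_sum : tsum (fun j => tsum (dterm (- 1) (- 1) 0 j)) =
  4 * P ^+ 2 * qpoch_inf (- s^-1) q.
Proof.
have -> : 4 * P ^+ 2 * qpoch_inf (- s^-1) q = 2 * P * (2 * P * qpoch_inf (- s ^ (- 1)) q).
  by rewrite exprN1; ring.
rewrite -bterm_sum -(tsumZ2 r01 _ (bterm_dom _)).
apply: eq_tsum => j; apply: eq_tsum => k.
rewrite /dterm /bterm addNr expr0z qpoch_inf_N1 opprK sz2 -(qpochMN q q k).
set u := s ^ _; set v := s ^ _.
have -> : u = v by rewrite /u /v; congr (s ^ _); ring.
by field; rewrite qq0 qq20 qqN0.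
Qed.

(** For [a = 1] the finite factor is [(-1; q)_k], which cancels nothing by itself. The two terms
    differ by a factor [q^k], and [(-1; q)_k (1 + q^k) = 2 (-q; q)_k] does cancel. *)
Lemma second_third_sum :
  tsum (fun j => tsum (dterm 1 2 (- 2) j)) + tsum (fun j => tsum (dterm 1 2 0 j))
  = 4 * P ^+ 3.
Proof.
have -> : 4 * P ^+ 3 = 2 * P * (2 * P * qpoch_inf (- s ^ 2) q).
  by rewrite sz2; ring.
rewrite -bterm_sum -(tsumZ2 r01 _ (bterm_dom _)) -(tsumD2 r01); [|exact: dterm_dom..].
apply: eq_tsum => j; apply: eq_tsum => k.
rewrite /dterm /bterm subrr expr0z sz2 -(qpochMN q q k).
have H := qpochN1 q k.
pose e : int := k%:Z ^+ 2 - k%:Z - 2 * j%:Z * k%:Z + 2 * j%:Z ^+ 2 + 2 * j%:Z.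
rewrite -/e.
have -> : s ^ (2 * j%:Z ^+ 2 + k%:Z ^+ 2 - 2 * j%:Z * k%:Z + 2 * j%:Z + (1 - 2) * k%:Z) = s ^ e.
  by congr (s ^ _); rewrite /e; ring.
have -> : s ^ (2 * j%:Z ^+ 2 + k%:Z ^+ 2 - 2 * j%:Z * k%:Z + 2 * j%:Z + (1 + 0) * k%:Z) = s ^ e * q ^+ k.
  by rewrite -(exprM s) (exprnP s) -sD; congr (s ^ _); rewrite /e PoszM; ring.
transitivity (s ^ e * (qpoch (- 1) q k * (1 + q ^+ k)) /
  (qpoch q2 q2 j * (qpoch q q k * qpoch (- q) q k)) * P); first by ring.
by rewrite H; field; rewrite qq0 qq20 qqN0.
Qed.


(** * The third sum, by parity of [k] *)

Definition wterm (k : nat) : R[i] :=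
  s ^ (k%:Z ^+ 2 + k%:Z) * qpoch (- 1) q k / qpoch q2 q2 k * P
  * qpoch_inf (- q ^ (2 - k%:Z)) q2.

(** The series in [j] has base [q^2], so Euler's formula is used with [q] in place of [s]. The
    resulting [(-q^(2 - k); q^2)_oo] moves by steps of [q^2], hence the split by parity. *)
Lemma dterm_column k : tsum (fun j => dterm 1 2 0 j k) = wterm k.
Proof.
have ed := euler_dom q_neq0 q1 (2 - k%:Z).
transitivity (s ^ (k%:Z ^+ 2 + k%:Z) * qpoch (- 1) q k / qpoch q2 q2 k * P *
  tsum (fun j : nat => q ^ (j%:Z ^+ 2 - j%:Z + (2 - k%:Z) * j%:Z) / qpoch q2 q2 j)).
  rewrite -(tsumZ (r := `|q|) _ _ ed) ?normr_ge0//; apply: eq_tsum => j.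
  rewrite /dterm subrr expr0z sz2 sQ; set A := s ^ _; set B := s ^ _; set D := s ^ _.
  have -> : A = B * D by rewrite /A /B /D -sD; congr (s ^ _); ring.
  by rewrite invfM; ring.
by rewrite (euler_sum q_neq0 q1).
Qed.

Lemma wterm_dom : dom `|s| wterm.
Proof.
have := dom2_dom_tsum r01 (dom2_tr (dterm_dom 1 2 0)).
by under eq_fun => k do rewrite dterm_column.
Qed.

Local Notation Q1 := (qpoch_inf (- q) q2).
Local Notation Q2 := (qpoch_inf (- q2) q2).

Let q20 n : qpoch q q2 n != 0. Proof. exact: qpoch_neq0 (ltW _). Qed.
Let q2N0 n : qpoch (- q) q2 n != 0.
Proof. by apply: qpoch_neq0 (ltW _) => //; rewrite normrN. Qed.
Let q2N20 n : qpoch (- q2) q2 n != 0.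
Proof. by apply: qpoch_neq0 (ltW _) => //; rewrite normrN. Qed.
Let q2D n : 1 + q2 ^+ n != 0.
Proof.
case: n => [|n]; first by rewrite expr0 (_ : 1 + 1 = 2%:R)// pnatr_eq0.
have := @sub1_neq0 R (- q2) q2 n; rewrite mulNr opprK -exprS normrN; apply => //.
exact: ltW.
Qed.
Let qD n : 1 + q * q2 ^+ n != 0.
Proof.
have := @sub1_neq0 R (- q) q2 n; rewrite mulNr opprK normrN; apply => //.
exact: ltW.
Qed.

(** Shifting to [(-q^2; q^2)_oo] and splitting all factorials by parity gives the series of
    [lambert_reduction] with [a = -1], [t = -q] and base [q^2]. *)
Lemma wterm_even m : wterm m.*2 = 2 * P * Q2 *
  (qcoef 0 (- q2) q2 m * (- q) ^+ m * qpoch (- 1) q2 m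
   / ((1 - (- 1) * q2 ^+ m) * qpoch (- 1 * - q) q2 m)).
Proof.
have -> : - 1 * - q = q by ring.
have -> : 1 - (- 1) * q2 ^+ m = 1 + q2 ^+ m by ring.
have H := qpochN1 q2 m; have u0 := q2D m; have E0 := q2N20 m.
rewrite qcoef0N /wterm -(qpochMN q q) !qpoch_double.
have -> : - 1 * q = - q by ring.
have -> : q * q = q2 by [].
have -> : - q * q = - q2 by rewrite mulNr.
have -> : 2 - m.*2%:Z = 2 - 2 * m%:Z by rewrite -mul2n PoszM.
rewrite (qpoch_inf_shift q_neq0 q1) subrr expr0z.
have -> : q ^ 2 = q2 by [].
have e : s ^ (m.*2%:Z ^+ 2 + m.*2%:Z) * q ^ (2 * m%:Z - m%:Z ^+ 2 - m%:Z) =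
    q ^+ (m * m + m) * q ^+ m.
  rewrite sQ -sD -exprD -(exprM s) (exprnP s) -mul2n; congr (s ^ _).
  by rewrite !(PoszM, PoszD); ring.
move: H u0 E0 (q2N0 m) (q20 m) (qq20 m) e; rewrite -/q2.
move: (qpoch (- 1) q2 m) (1 + q2 ^+ m) (qpoch (- q2) q2 m) (qpoch (- q) q2 m)
  (qpoch q q2 m) (qpoch q2 q2 m) (s ^ _) (q ^ _) (q ^+ (m * m + m)) (q ^+ m) (P) (Q2).
move=> A u E Aq B D x y z w p p2 H u0 E0 Aq0 B0 D0 e.
transitivity (x * y * A / (B * D) / E * A * p * p2).
  by field; rewrite B0 D0 Aq0 E0.
(* Expanding by [u = 1 + q^(2 m)] makes [qpochN1] applicable to one of the two factors [A]. *)
have -> : x * y * A / (B * D) / E * A * p * p2 = x * y * A / (B * D) / (E * u) * (A * u) * p * p2.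
  by field; rewrite B0 D0 E0 u0.
by rewrite H e; field; rewrite B0 D0 E0 u0.
Qed.

(** Here the shift ends at [(-q; q^2)_oo], and the series is that of [lambert_reduction] with
    [a = -q], [t = -q^2] and base [q^2]. *)
Lemma wterm_odd m : wterm m.*2.+1 = 2 * q * P * Q1 / (1 - q) *
  (qcoef 0 (- q2) q2 m * (- q2) ^+ m * qpoch (- q) q2 m
   / ((1 - (- q) * q2 ^+ m) * qpoch (- q * - q2) q2 m)).
Proof.
have -> : - q * - q2 = q * q2 by ring.
have -> : 1 - (- q) * q2 ^+ m = 1 + q * q2 ^+ m by ring.
have u0 := qD m.
have a0 : 1 - q != 0 by have := @sub1_neq0 R q q 0 q1 (ltW q1); rewrite expr0 mulr1.
have C0 : qpoch (q * q2) q2 m != 0.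
  have := q20 m.+1; rewrite qpochSl mulf_eq0 negb_or; by case/andP.
rewrite qcoef0N /wterm -(qpochMN q q) !qpoch_doubleS qpochSl [qpoch q q2 m.+1]qpochSl.
rewrite [qpoch (- q) q2 m.+1]qpochS.
have -> : 1 - - q * q2 ^+ m = 1 + q * q2 ^+ m by ring.
have -> : - 1 * q = - q by ring.
have -> : - 1 * q2 = - q2 by ring.
have -> : q * q = q2 by [].
have -> : - q * q = - q2 by rewrite mulNr.
have -> : 2 - m.*2.+1%:Z = 1 - 2 * m%:Z.
  by rewrite doubleS_intr; ring.
have -> : 1 - - 1 = 2 :> R[i] by ring.
rewrite (qpoch_inf_shift q_neq0 q1).
have -> : q ^ (2 - 1) = q by [].
have e : s ^ (m.*2.+1%:Z ^+ 2 + m.*2.+1%:Z) * q ^ (1 * m%:Z - m%:Z ^+ 2 - m%:Z) =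
    q * (q ^+ (m * m + m) * q2 ^+ m).
  rewrite sQ -sD -(exprM q) -exprD -exprS -(exprM s) (exprnP s) -mul2n; congr (s ^ _).
  by rewrite -addn1 !(PoszM, PoszD) -[(_ + _).+1]addn1 !(PoszM, PoszD); ring.
move: u0 a0 C0 (q2N20 m) (q2N0 m) (qq20 m) e.
move: (qpoch (q * q2) q2 m) (qpoch (- q2) q2 m) (qpoch (- q) q2 m)
  (qpoch q2 q2 m) (s ^ _) (q ^ _) (q ^+ (m * m + m)) (q2 ^+ m) (P) (Q1) (1 + q * q2 ^+ m).
move=> C E Aq D x y z w p p1 u u0 a0 C0 E0 Aq0 D0 e.
transitivity (2 * p * p1 * (x * y) * Aq / ((1 - q) * C * u * D)).
  by field; rewrite a0 C0 D0 Aq0 E0 u0.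
by rewrite e; field; rewrite a0 C0 D0 u0.
Qed.

Let norm_q_sq (x : R[i]) : `|x| <= `|q| -> `|x| <= `|s| ^+ 2.
Proof. by rewrite normrX. Qed.

Let q2q : `|q2| <= `|q|.
Proof. by rewrite normrX expr2 ler_piMl// ltW. Qed.

(** After the Lambert reduction both halves have the prefactor [2 P Q1 Q2 / (q; q^2)_oo = 2 P^3],
    and [lambert_half] evaluates what it multiplies to [1 / 2]. *)
Lemma third_sum : tsum (fun j => tsum (dterm 1 2 0 j)) = P ^+ 3.
Proof.
rewrite (tsum_exchange r01 (dterm_dom 1 2 0)) (eq_tsum dterm_column).
rewrite (tsum_parity r01 wterm_dom) (eq_tsum wterm_even) (eq_tsum wterm_odd).
have nE : `|- q| <= `|s| ^+ 2 by apply: norm_q_sq; rewrite normrN.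
have nO : `|- q2| <= `|s| ^+ 2 by apply: norm_q_sq; rewrite normrN.
have aE : `|- 1 * - q| < 1 by rewrite mulrNN mul1r.
have aO : `|- q * - q2| < 1.
  by rewrite mulrNN normrM mulr_ilt1.
have dE k : 1 - (- 1) * q2 ^+ k != 0 by rewrite mulN1r opprK.
have dO k : 1 - (- q) * q2 ^+ k != 0 by rewrite mulNr opprK.
have bO : bnd (fun k => (1 - (- q) * q2 ^+ k)^-1).
  exists (1 - `|q|)^-1 => k; rewrite normfV lef_pV2 ?posrE ?subr_gt0 ?normr_gt0//.
  by rewrite -[`|q|]normrN norm1B_ge// ltW.
have bE : bnd (fun k => (1 - (- 1) * q2 ^+ k)^-1).
  (* As [a = -1] has norm 1, [norm1B_ge] is useful only from [k = 1] on; the factor at [k = 0] is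
     2. *)
  exists (1 - `|q2|)^-1 => -[|k]; rewrite normfV lef_pV2 ?posrE ?subr_gt0 ?normr_gt0//.
    rewrite expr0 mulr1 opprK (_ : 1 + 1 = 2%:R)// normr_nat lerBlDr.
    by rewrite (le_trans (ler1n _ 2))// lerDl.
  by rewrite [q2 ^+ k.+1]exprS mulrA mulN1r -[`|q2|]normrN norm1B_ge// ltW.
rewrite (tsumZ r01 _ (lambert_dom r01 q2r nE aE bE)).
rewrite (tsumZ r01 _ (lambert_dom r01 q2r nO aO bO)).
rewrite (lambert_reduction r01 q2r nE aE dE bE) (lambert_reduction r01 q2r nO aO dO bO).
have H := lambert_half q1.
rewrite (@eq_tsum R _ (fun n => (- q) ^+ n / (1 + q2 ^+ n))); last first.
  by move=> n; rewrite mulN1r opprK.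
rewrite (@eq_tsum R (fun n => (- q2) ^+ n / (1 - - q * q2 ^+ n))
  (fun n => (- q2) ^+ n / (1 + q * q2 ^+ n))); last first.
  by move=> n; rewrite mulNr opprK.
have PQ : P = Q1 * Q2 by rewrite (qpoch_inf_double r01 _ qr) mulNr.
have qE : qpoch_inf q q2 = (1 - q) * qpoch_inf (- q * - q2) q2.
  rewrite (qpoch_inf_split r01 _ 1 q2r) qpochS qpoch0 expr0 expr1 mul1r mulr1 mulrNN.
  by [].
(* Euler's identity for odd and distinct parts: [(q^2; q^2)_oo] is cancelled between two
   factorizations involving [(q; q)_oo]. *)
have qP : qpoch_inf q q2 * P = 1.
  have nz : qpoch_inf q2 q2 != 0 by exact: (qpoch_inf_neq0 r01).
  have d : qpoch_inf q q = qpoch_inf q q2 * qpoch_inf q2 q2.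
    exact: (qpoch_inf_double r01 q qr).
  have n : qpoch_inf q q * P = qpoch_inf q2 q2 by exact: (qpoch_infMN r01 q qr).
  by apply: (mulfI nz); rewrite mulr1 mulrA (mulrC (qpoch_inf q2 q2)) -d.
have nz : qpoch_inf q q2 != 0 by exact: (qpoch_inf_neq0 r01).
have a0 : 1 - q != 0 by have := @sub1_neq0 R q q 0 q1 (ltW q1); rewrite expr0 mulr1.
have nz' : qpoch_inf (- q * - q2) q2 != 0 by exact: (qpoch_inf_neq0 r01).
rewrite mulrNN mul1r.
have PE : P = (qpoch_inf q q2)^-1 by apply: (mulfI nz); rewrite qP mulfV.
set X := tsum _ in H *; set Y := tsum _ in H *.
transitivity (2 * P * (Q1 * Q2) / qpoch_inf q q2 * (X + q * Y)).
  rewrite qE; move: X Y {H} P Q1 Q2 (qpoch_inf (- q * - q2) q2) nz'.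
  by move=> X Y p p1 p2 c c0; field; rewrite a0 c0.
by rewrite H -PQ -PE; field.
Qed.

(** * The infinite products on the right-hand sides *)

Lemma qpoch_inf_quotient : qpoch_inf q2 q2 / qpoch_inf q q = P.
Proof.
rewrite -(qpoch_infMN r01 q qr) mulrC mulKf//; exact: (qpoch_inf_neq0 r01).
Qed.

(** Combines [(s; s)_oo (-s; s)_oo = (q; q)_oo] with the parity split
    [(-s; s)_oo = (-s; q)_oo P]. *)
Lemma qpoch_inf_half_quotient :
  qpoch_inf q2 q2 / qpoch_inf s s = P ^+ 2 * qpoch_inf (- s) q.
Proof.
have sr : `|s| <= `|s| by [].
have nz : qpoch_inf s s != 0 by exact: (qpoch_inf_neq0 r01).
have d : qpoch_inf (- s) s = qpoch_inf (- s) q * P.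
  by rewrite (qpoch_inf_double r01 (- s) sr) mulNr.
have n : qpoch_inf s s * qpoch_inf (- s) s = qpoch_inf q q by exact: (qpoch_infMN r01).
have n2 : qpoch_inf q q * P = qpoch_inf q2 q2 by exact: (qpoch_infMN r01).
apply: (mulIf nz).
rewrite (mulfVK nz) -n2 -n d.
by move: (qpoch_inf s s) (qpoch_inf (- s) q) P => a b c; ring.
Qed.

End TripleSums.

(* s plays the role of q^{1/2}; q^{e} for e in (1/2)Z is written s ^ (2e). *)
Theorem theorem1p3 (R : realType) (q s : R[i]) :
  s ^+ 2 = q -> q != 0 -> `|q| < 1 ->
  [/\ cube_sum (fun i j k : nat =>
         s ^ ((i%:Z)^+2 + 2 * (j%:Z)^+2 + 2 * (k%:Z)^+2
              - 2 * i%:Z * k%:Z - 2 * j%:Z * k%:Z - i%:Z - j%:Z)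
         / (qpoch q q i * qpoch (q ^+ 2) (q ^+ 2) j * qpoch (q ^+ 2) (q ^+ 2) k))
       @ \oo --> 4 * (1 + s^-1) * qpoch_inf (q ^+ 2) (q ^+ 2) / qpoch_inf s s,
      cube_sum (fun i j k : nat =>
         s ^ ((i%:Z)^+2 + 2 * (j%:Z)^+2 + 2 * (k%:Z)^+2
              - 2 * i%:Z * k%:Z - 2 * j%:Z * k%:Z + i%:Z + 2 * j%:Z - 2 * k%:Z)
         / (qpoch q q i * qpoch (q ^+ 2) (q ^+ 2) j * qpoch (q ^+ 2) (q ^+ 2) k))
       @ \oo --> 3 * qpoch_inf (q ^+ 2) (q ^+ 2) ^+ 3 / qpoch_inf q q ^+ 3
    & cube_sum (fun i j k : nat =>
         s ^ ((i%:Z)^+2 + 2 * (j%:Z)^+2 + 2 * (k%:Z)^+2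
              - 2 * i%:Z * k%:Z - 2 * j%:Z * k%:Z + i%:Z + 2 * j%:Z)
         / (qpoch q q i * qpoch (q ^+ 2) (q ^+ 2) j * qpoch (q ^+ 2) (q ^+ 2) k))
       @ \oo --> qpoch_inf (q ^+ 2) (q ^+ 2) ^+ 3 / qpoch_inf q q ^+ 3].
Proof.
move=> <- q0 q1.
have s0 : s != 0 by apply: contraNneq q0 => ->; rewrite expr0n.
have s1 : `|s| < 1.
  by rewrite -(@expr_lt1 _ 2)// -normrX.
have r01 : 0 <= `|s| < 1 by rewrite normr_ge0.
have sr : `|s ^+ 2| <= `|s| by rewrite normrX expr2 ler_piMl// ltW.
have T3 := third_sum s0 s1.
have T2 := second_third_sum s0 s1; rewrite T3 in T2.
have cubes : qpoch_inf (s ^+ 2 ^+ 2) (s ^+ 2 ^+ 2) ^+ 3 / qpoch_inf (s ^+ 2) (s ^+ 2) ^+ 3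
    = qpoch_inf (- s ^+ 2) (s ^+ 2) ^+ 3.
  by rewrite -expr_div_n qpoch_inf_quotient.
split.
- have -> : 4 * (1 + s^-1) * qpoch_inf (s ^+ 2 ^+ 2) (s ^+ 2 ^+ 2) / qpoch_inf s s =
      tsum (fun j => tsum (dterm s (- 1) (- 1) 0 j)).
    rewrite (first_sum s0 s1) -mulrA (qpoch_inf_half_quotient s1).
    (* The first factor of [(-s^-1; q)_oo] is [1 + s^-1], and [s^-1 q = s] leaves [(-s; q)_oo]. *)
    rewrite (qpoch_inf_split r01 (- s^-1) 1 sr) qpochS qpoch0 expr0 expr1 mulr1 mul1r opprK.
    have -> : - s^-1 * s ^+ 2 = - s by field.
    by move: (qpoch_inf _ _) (qpoch_inf _ _) => *; ring.
  rewrite (_ : (fun i j k : nat => _) = tterm s (- 1) (- 1) 0); first exact: tterm_cvg.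
  apply/funext => i; apply/funext => j; apply/funext => k.
  by rewrite /tterm; congr (s ^ _ / _); ring.
- have -> : 3 * qpoch_inf (s ^+ 2 ^+ 2) (s ^+ 2 ^+ 2) ^+ 3 / qpoch_inf (s ^+ 2) (s ^+ 2) ^+ 3 =
      tsum (fun j => tsum (dterm s 1 2 (- 2) j)).
    (* Adding the third sum [P^3] to both sides reduces the claim to [3 P^3 + P^3 = 4 P^3]. *)
    rewrite -mulrA cubes; apply: (addIr (qpoch_inf (- s ^+ 2) (s ^+ 2) ^+ 3)); rewrite T2.
    by move: (qpoch_inf _ _) => *; ring.
  rewrite (_ : (fun i j k : nat => _) = tterm s 1 2 (- 2)); first exact: tterm_cvg.
  apply/funext => i; apply/funext => j; apply/funext => k.
  by rewrite /tterm; congr (s ^ _ / _); ring.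
- rewrite cubes -T3.
  rewrite (_ : (fun i j k : nat => _) = tterm s 1 2 0); first exact: tterm_cvg.
  apply/funext => i; apply/funext => j; apply/funext => k.
  by rewrite /tterm; congr (s ^ _ / _); ring.
Qed.
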